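(* Let $w>0$ and let $W=\{W_{jk}\}_{j,k=1}^{\infty}$ be the semi-infinite random Hermitian matrix whose entries are complex Gaussian random variables (independent modulo the Hermitian symmetry, real on the diagonal) with $$\mathbf{E}(W_{jk})=0,\qquad \mathbf{E}(W_{jk}\overline{W_{lm}})=2w^{2}\delta_{jl}\delta_{km}.$$ For each $n$ let $M_n=n^{-1/2}W_n$ where $W_n=\{W_{jk}\}_{j,k=1}^{n}$ (the Gaussian Unitary Ensemble), and let $N_n$ be the normalized eigenvalue counting measure of $M_n$. Then, with probability 1, the sequence of measures $N_n$ converges weakly as $n\to\infty$ to the nonrandom measure $$N_{sc}(\Delta)=\frac{1}{4\pi w^{2}}\int_{\Delta\cap[-2\sqrt{2}w,\,2\sqrt{2}w]}\sqrt{8w^{2}-\lambda^{2}}\,d\lambda,\qquad \Delta\subset\mathbf{R}\ \text{Borel},$$ i.e. the measure with density $\rho_{sc}(\lambda)=(4\pi w^{2})^{-1}\sqrt{8w^{2}-\lambda^{2}}$ concentrated on $[-2\sqrt{2}w,2\sqrt{2}w]$.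
   Context: For a Hermitian $n\times n$ matrix $M_n$ with eigenvalues $\lambda_1^{(n)},\dots,\lambda_n^{(n)}$ (counted with multiplicity), the normalized eigenvalue counting measure is $N_n(\Delta)=\frac1n\#\{i:\lambda_i^{(n)}\in\Delta\}$ for Borel $\Delta\subset\mathbf{R}$. The law of $M_n$ is equivalently $P_n(dM)=Z_n^{-1}\exp\left(-\frac{n}{4w^2}\operatorname{Tr}M^2\right)dM$, where $dM=\prod_{1\le j\le n}dM_{jj}\prod_{1\le j<k\le n}d\,\mathrm{Re}\,M_{jk}\,d\,\mathrm{Im}\,M_{jk}$ is Lebesgue measure on the space of Hermitian $n\times n$ matrices. All the $M_n$ are defined on the common probability space of semi-infinite Hermitian matrices $W$ with the infinite product Gaussian measure. *)

(* Defs.v *)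
From HB Require Import structures.
From mathcomp Require Import all_boot all_order all_algebra.
From mathcomp Require Import all_classical all_reals all_analysis.
From mathcomp Require Import measurable_realfun complex.

Set Implicit Arguments.
Unset Strict Implicit.
Unset Printing Implicit Defensive.

Import Order.TTheory GRing.Theory Num.Theory.
Import numFieldTopology.Exports numFieldNormedType.Exports.

Local Open Scope classical_set_scope.
Local Open Scope ring_scope.
Local Open Scope complex_scope.

Section complex_random_variables.
Context {d : measure_display} {T : measurableType d} {R : realType}.
Variable P : probability T R.

(* A complex random variable is measured through (Re Z, Im Z), i.e. for the
   Borel sigma-algebra of R^2. *)
Definition reim (Z : T -> R[i]) (t : T) : measurableTypeR R * measurableTypeR R :=
  (complex.Re (Z t), complex.Im (Z t)).

Definition cexpectation (Z : T -> R[i]) : R[i] :=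
  (\int[P]_t complex.Re (Z t)) +i* (\int[P]_t complex.Im (Z t)).

(* Constants count as (degenerate) Gaussian variables; they are listed apart
   because [normal_prob m 0] is not the point mass at m in the library. *)
Definition gaussian_rv (X : T -> R) : Prop :=
  measurable_fun [set: T] (X : T -> measurableTypeR R) /\
  ((exists m s : R, 0 < s /\
     forall A : set (measurableTypeR R), measurable A ->
       P (X @^-1` A) = normal_prob m s A) \/
   (exists m : R,
     forall A : set (measurableTypeR R), measurable A ->
       P (X @^-1` A) = \d_m A)).

(* (Re Z, Im Z) is a jointly Gaussian vector; the variances and the covariance
   of the two parts are left free, so real Gaussian variables are included. *)
Definition complex_gaussian_rv (Z : T -> R[i]) : Prop :=
  measurable_fun [set: T] (reim Z) /\
  forall a b : R,
    gaussian_rv (fun t => a * complex.Re (Z t) + b * complex.Im (Z t)).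

Definition mutually_independent (I : choiceType) (D : set I)
    (Z : I -> T -> R[i]) : Prop :=
  forall (s : seq I) (B : I -> set (measurableTypeR R * measurableTypeR R)),
    uniq s ->
    (forall i, i \in s -> D i) ->
    (forall i, i \in s -> measurable (B i)) ->
    P (\bigcap_(i in [set` s]) (reim (Z i) @^-1` B i)) =
    (\prod_(i <- s) P (reim (Z i) @^-1` B i))%E.

End complex_random_variables.

Section spectrum.
Context {R : realType}.

Definition eigenvalues (n : nat) (M : 'M[R[i]]_n) : seq R[i] :=
  sval (closed_field_poly_normal (char_poly M)).

Lemma char_poly_eigenvalues (n : nat) (M : 'M[R[i]]_n) :
  char_poly M = \prod_(z <- eigenvalues M) ('X - z%:P).
Proof.
rewrite /eigenvalues; case: closed_field_poly_normal => r /= {1}->.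
by rewrite (monicP (char_poly_monic M)) scale1r.
Qed.

Lemma size_eigenvalues (n : nat) (M : 'M[R[i]]_n) : size (eigenvalues M) = n.
Proof.
have := size_char_poly M.
by rewrite char_poly_eigenvalues size_prod_XsubC => -[].
Qed.

Definition hermitian_mx (n : nat) (M : 'M[R[i]]_n) : Prop :=
  forall j k, M j k = (M k j)^*.

Lemma hermitian_eigenvalue_real (n : nat) (M : 'M[R[i]]_n) (z : R[i]) :
  hermitian_mx M -> z \in eigenvalues M -> z = (complex.Re z)%:C.
Proof.
move=> hM zM.
have : root (char_poly M) z by rewrite char_poly_eigenvalues root_prod_XsubC.
rewrite -eigenvalue_root_char => /eigenvalueP[v vM v0].
pose c := \sum_j v 0 j * (v 0 j)^*.
have c0 : c != 0.
  apply/negP => /eqP c0; move/negP: v0; apply; apply/eqP/rowP => j.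
  rewrite mxE; apply/eqP; rewrite -normr_eq0 -sqrf_eq0 sqr_normc.
  have := @psumr_eq0P _ _ xpredT (fun j => v 0 j * (v 0 j)^*).
  by move=> -> // i _; rewrite -sqr_normc exprn_ge0.
have E j : \sum_k v 0 k * M k j = z * v 0 j.
  by have := congr1 (fun u : 'rV_n => u 0 j) vM; rewrite /= !mxE.
have H1 : \sum_j (\sum_k v 0 k * M k j) * (v 0 j)^* = z * c.
  by rewrite mulr_sumr; apply: eq_bigr => j _; rewrite E mulrA.
have H2 : \sum_j (\sum_k v 0 k * M k j) * (v 0 j)^* = z^* * c.
  under eq_bigr do rewrite mulr_suml.
  rewrite exchange_big mulr_sumr; apply: eq_bigr => k _ /=.
  rewrite mulrCA -rmorphM -E rmorph_sum mulr_sumr; apply: eq_bigr => j _ /=.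
  by rewrite rmorphM /= (hM k j) mulrAC mulrA.
have /(mulIf c0) : z * c = z^* * c by rewrite -H1.
clear; case: z => a b [/eqP]; rewrite -addr_eq0 -mulr2n mulrn_eq0 /=.
by move=> /eqP ->.
Qed.

(* The real parts make this a measure on the line for every matrix; they are the
   eigenvalues themselves when M is Hermitian (hermitian_eigenvalue_real).  For
   n = 0 this is the null measure. *)
Definition eigenvalue_measure (n : nat) (M : 'M[R[i]]_n) :
    {measure set (measurableTypeR R) -> \bar R} :=
  mscale (n%:R^-1 : R)%:nng
    (msum (fun k => \d_(complex.Re (eigenvalues M)`_k : measurableTypeR R)) n).

Lemma eigenvalue_measureE (n : nat) (M : 'M[R[i]]_n)
    (A : set (measurableTypeR R)) :
  eigenvalue_measure M A =
  (n%:R^-1 * (count (fun z => complex.Re z \in A) (eigenvalues M))%:R)%:E.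
Proof.
rewrite /eigenvalue_measure /= /mscale /= EFinM; congr (_ * _)%E.
rewrite /msum -sum1_count (big_nth 0) size_eigenvalues big_mkord natr_sum.
rewrite -sumEFin [RHS]big_mkcond /=; apply: eq_bigr => k _.
by rewrite diracE; case: (_ \in A).
Qed.

End spectrum.

Section semicircle.
Context {R : realType}.
Variable w : R.

Definition semicircle_pdf (x : R) : R :=
  (4 * pi * w ^+ 2)^-1 * Num.sqrt (8 * w ^+ 2 - x ^+ 2).

Definition semicircle_support : set R :=
  `[- (2 * Num.sqrt 2 * w), 2 * Num.sqrt 2 * w].

Definition semicircle (A : set (measurableTypeR R)) : \bar R :=
  (\int[lebesgue_measure]_(x in A `&` semicircle_support)
     (semicircle_pdf x)%:E)%E.

Lemma semicircle_pdf_ge0 x : 0 <= semicircle_pdf x.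
Proof.
by rewrite mulr_ge0 ?sqrtr_ge0// invr_ge0 mulr_ge0 ?sqr_ge0// mulr_ge0 ?pi_ge0.
Qed.

Lemma continuous_semicircle_pdf : continuous semicircle_pdf.
Proof.
move=> x; apply: cvgM; first exact: cvg_cst.
apply: (cvg_comp (fun x => 8 * w ^+ 2 - x ^+ 2) Num.sqrt); last first.
  exact: sqrt_continuous.
apply: (@cvgB _ R^o); first exact: cvg_cst.
exact: exprn_continuous.
Qed.

Lemma measurable_semicircle_pdf (D : set (measurableTypeR R)) :
  measurable_fun D semicircle_pdf.
Proof.
apply: measurable_funTS; apply: continuous_measurable_fun.
exact: continuous_semicircle_pdf.
Qed.

Let semicircle0 : semicircle set0 = 0%E.
Proof. by rewrite /semicircle set0I integral_set0. Qed.

Let semicircle_ge0 A : (0 <= semicircle A)%E.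
Proof.
by apply: integral_ge0 => x _; rewrite lee_fin semicircle_pdf_ge0.
Qed.

Let semicircle_sigma_additive : semi_sigma_additive semicircle.
Proof.
move=> /= A mA tA mUA; rewrite /semicircle setI_bigcupl.
rewrite ge0_integral_bigcup//=; first last.
- exact: trivIset_setIr.
- by move=> x _; rewrite lee_fin semicircle_pdf_ge0.
- by apply/measurable_EFinP; exact: measurable_semicircle_pdf.
- by move=> k; apply: measurableI => //; exact: measurable_itv.
apply: is_cvg_ereal_nneg_natsum_cond => n _ _.
by apply: integral_ge0 => x _; rewrite lee_fin semicircle_pdf_ge0.
Qed.

HB.instance Definition _ := isMeasure.Build _ _ _
  semicircle semicircle0 semicircle_ge0 semicircle_sigma_additive.

End semicircle.

Definition weakly_converges {R : realType}
    (mu : nat -> {measure set (measurableTypeR R) -> \bar R})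
    (nu : {measure set (measurableTypeR R) -> \bar R}) : Prop :=
  forall f : R -> R, continuous f -> (exists C : R, forall x, `|f x| <= C) ->
    (\int[mu n]_x (f x)%:E)%E @[n --> \oo] --> (\int[nu]_x (f x)%:E)%E.

(* Rows and columns are numbered from 0. *)
Definition truncation {R : realType} (A : nat -> nat -> R[i]) (n : nat) :
    'M[R[i]]_n :=
  \matrix_(j < n, k < n) A j k.

Definition normalized_truncation {R : realType} (A : nat -> nat -> R[i])
    (n : nat) : 'M[R[i]]_n :=
  ((Num.sqrt n%:R)^-1)%:C *: truncation A n.

(* Main.v *)
Require Import Defs.
From HB Require Import structures.
From mathcomp Require Import all_boot all_order all_algebra.
From mathcomp Require Import all_classical all_reals all_analysis.
From mathcomp Require Import measurable_realfun complex.
From mathcomp Require Import ring lra zify.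

Set Implicit Arguments.
Unset Strict Implicit.
Unset Printing Implicit Defensive.

Import Order.TTheory GRing.Theory Num.Theory.
Import numFieldTopology.Exports numFieldNormedType.Exports.

Local Open Scope classical_set_scope.
Local Open Scope ring_scope.
Local Open Scope complex_scope.

(** The proof is the moment method, with Gaussian integration by parts in place of
    the combinatorics of pairings.

    Write [t k] for the normalized trace of the [k]-th power of the matrix, that is,
    the [k]-th moment of its eigenvalue measure.  Integrating by parts one factor of
    the trace (schwinger_dyson) gives, for every product [X] of such traces,
      E (t k.+1 X) = 2 w^2 * \sum_(s < k) E (t s * t (k - s - 1) * X) + R / n^2,
    where [R] is a combination, with coefficients that depend neither on [n] nor on
    the matrix, of expectations of products of traces.  Everything on the right has
    smaller degree, so one induction (mixed_moment_asymptotics) shows that the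
    expectation of a product of traces is the product of the numbers [m k] up to
    O(1/n^2), where [m] solves m k.+1 = 2 w^2 * \sum_(s < k) m s * m (k - s - 1).
    Applied to two traces this bounds the mean square of [t k - m k] by C / n^2, which
    is summable; hence, almost surely, all moments converge (ae_cvg_square_rate).

    The moments of the semicircle law satisfy a two-term recursion, obtained by
    integrating a derivative, and that recursion implies the convolution identity
    above (catalan_convolution); so [m k] are these moments.  As the limit has
    compact support, convergence of the moments gives weak convergence, by polynomial
    approximation on a segment larger than the support (cvg_empirical_mean).

    Integration by parts only concerns polynomials in the entries.  For monomials it
    is Wick's rule (wick): independence separates the two entries with indices
    [(j, k)] and [(k, j)] from the others (expectM_function_of), and what remains is
    a statement on the moments of one complex Gaussian variable
    (circular_gaussian_moments), which follows from those of its real linear forms.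
    All expectations are taken on the commutative ring of the random variables whose
    moments are all finite, so that the algebra can be carried out in a ring with a
    linear functional. *)

(** * Gaussian integration by parts for polynomials, and the trace identities *)

Section gaussian_integration_by_parts.
Variables (K A : comPzRingType) (cst : {rmorphism K -> A}) (E : {additive A -> K}).
Hypothesis Ecst : forall c x, E (cst c * x) = c * E x.
Variable X : nat * nat -> A.

Definition monomial (L : seq (nat * nat)) : A := \prod_(p <- L) X p.

Definition transpose (p : nat * nat) : nat * nat := (p.2, p.1).

Fixpoint dmonomial (q : nat * nat) (L : seq (nat * nat)) : A :=
  if L is p :: L' then (p == q)%:R * monomial L' + X p * dmonomial q L' else 0.

Lemma monomial_cons p L : monomial (p :: L) = X p * monomial L.
Proof. exact: big_cons. Qed.

Lemma monomial_cat L1 L2 : monomial (L1 ++ L2) = monomial L1 * monomial L2.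
Proof. exact: big_cat. Qed.

Lemma dmonomial_cat q L1 L2 : dmonomial q (L1 ++ L2) =
  dmonomial q L1 * monomial L2 + monomial L1 * dmonomial q L2.
Proof.
elim: L1 => [|p L1 IH] /=; first by rewrite /monomial big_nil mul0r add0r mul1r.
by rewrite IH monomial_cat monomial_cons; ring.
Qed.

(** Formal differentiation in the variable [X q] is a relation and not a function,
    since an element of [A] need not determine a polynomial in the entries. *)
Inductive poly_deriv (q : nat * nat) : A -> A -> Prop :=
| Poly_deriv_monomial L : poly_deriv q (monomial L) (dmonomial q L)
| Poly_deriv_scale c G G' :
    poly_deriv q G G' -> poly_deriv q (cst c * G) (cst c * G')
| Poly_deriv_add G G' H H' :
    poly_deriv q G G' -> poly_deriv q H H' -> poly_deriv q (G + H) (G' + H').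

Lemma poly_deriv_eq q G G' H H' :
  poly_deriv q G G' -> G = H -> G' = H' -> poly_deriv q H H'.
Proof. by move=> h <- <-. Qed.

Lemma poly_derivM q G G' H H' : poly_deriv q G G' -> poly_deriv q H H' ->
  poly_deriv q (G * H) (G' * H + G * H').
Proof.
move=> hG; elim: hG H H' => [L|c F F' _ IH|F F' G1 G1' _ IH1 _ IH2] H H' hH.
- elim: hH => [L2|c F F' _ IH|F F' G1 G1' _ IH1 _ IH2].
  + by rewrite -monomial_cat -dmonomial_cat; constructor.
  + by apply: (poly_deriv_eq (Poly_deriv_scale c IH)); ring.
  + by apply: (poly_deriv_eq (Poly_deriv_add IH1 IH2)); ring.
- by apply: (poly_deriv_eq (Poly_deriv_scale c (IH _ _ hH))); ring.
- by apply: (poly_deriv_eq (Poly_deriv_add (IH1 _ _ hH) (IH2 _ _ hH))); ring.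
Qed.

Lemma poly_deriv1 q : poly_deriv q 1 0.
Proof. by have := Poly_deriv_monomial q [::]; rewrite /monomial big_nil. Qed.

Lemma poly_deriv0 q : poly_deriv q 0 0.
Proof.
by apply: (poly_deriv_eq (Poly_deriv_scale 0 (poly_deriv1 q)));
  rewrite rmorph0 mul0r.
Qed.

Lemma poly_derivX q p : poly_deriv q (X p) (p == q)%:R.
Proof.
apply: (poly_deriv_eq (Poly_deriv_monomial q [:: p]));
  rewrite /= /monomial ?big_cons big_nil; ring.
Qed.

Lemma poly_deriv_sum q (I : Type) (r : seq I) (F F' : I -> A) :
  (forall i, poly_deriv q (F i) (F' i)) ->
  poly_deriv q (\sum_(i <- r) F i) (\sum_(i <- r) F' i).
Proof.
move=> h; elim: r => [|i r IH]; first by rewrite !big_nil; exact: poly_deriv0.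
by rewrite !big_cons; apply: Poly_deriv_add.
Qed.

Variable v : K.

(* Wick's rule for a Gaussian matrix in which only transposed entries are
   correlated. *)
Hypothesis Wick : forall p L,
  E (X p * monomial L) = v * E (dmonomial (transpose p) L).

Lemma integration_by_parts p G G' :
  poly_deriv (transpose p) G G' -> E (X p * G) = v * E G'.
Proof.
elim=> [L|c H H' _ IH|H H' G1 G1' _ IH1 _ IH2]; first exact: Wick.
- by rewrite mulrCA !Ecst IH; ring.
- by rewrite mulrDr !raddfD /= IH1 IH2; ring.
Qed.

Section traces.
Variables (n : nat) (r : K).

Definition scaled_matrix : 'M[A]_n := \matrix_(j, k) (cst r * X (val j, val k)).
Let M := scaled_matrix.

Definition trace_power k : A := \tr (M ^+ k).
Let T := trace_power.

Lemma poly_deriv_matrix_power (c d : 'I_n) k a b :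
  poly_deriv (val c, val d) ((M ^+ k) a b)
    (cst r * \sum_(s < k) (M ^+ s) a c * (M ^+ (k - s.+1)) d b).
Proof.
elim: k a b => [|k IH] a b.
  rewrite big_ord0 mulr0 expr0 mxE.
  by case: (a == b); [exact: poly_deriv1 | exact: poly_deriv0].
apply: (@poly_deriv_eq _ (\sum_e M a e * (M ^+ k) e b)); last 2 first.
- by rewrite exprS -mulmxE mxE.
- reflexivity.
apply: (@poly_deriv_eq _ _ (\sum_e (cst r * (((val a, val e) == (val c, val d))%:R)
    * (M ^+ k) e b + M a e * (cst r * \sum_(s < k) (M ^+ s) e c * (M ^+ (k - s.+1)) d b)))).
- apply: poly_deriv_sum => e; apply: poly_derivM; last exact: IH.
  by rewrite mxE; apply: Poly_deriv_scale; exact: poly_derivX.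
- by [].
rewrite big_split /= big_ord_recl mulrDr; congr (_ + _).
  rewrite (bigD1 d) //= big1 ?addr0 => [|e ed].
    rewrite expr0 mxE subn1 /= -mulrA; congr (_ * (_ * _)).
    by rewrite xpair_eqE eqxx andbT (inj_eq val_inj).
  by rewrite xpair_eqE [_ == val d](negbTE ed) andbF mulr0 mul0r.
under eq_bigr do rewrite mulrCA.
rewrite -mulr_sumr; congr (_ * _).
under eq_bigr do rewrite mulr_sumr.
rewrite exchange_big; apply: eq_bigr => s _ /=.
rewrite /bump leq0n add1n subSS.
rewrite exprS -mulmxE mxE mulr_suml; apply: eq_bigr => e _.
by rewrite mulrA.
Qed.

Lemma poly_deriv_trace (c d : 'I_n) k :
  poly_deriv (val c, val d) (T k) (cst r * ((M ^+ k.-1) d c *+ k)).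
Proof.
apply: (poly_deriv_eq (poly_deriv_sum _
  (fun a => poly_deriv_matrix_power c d k a a))) => //.
rewrite -mulr_sumr exchange_big /=; congr (_ * _).
transitivity (\sum_(s < k) (M ^+ k.-1) d c); last first.
  by rewrite sumr_const card_ord.
apply: eq_bigr => s _.
under eq_bigr do rewrite mulrC.
have -> : (k.-1 = (k - s.+1) + s)%N by have := ltn_ord s; lia.
by rewrite exprD -mulmxE mxE.
Qed.

Definition trace_product (l : seq nat) : A := \prod_(k <- l) T k.

Lemma trace_product_cons k l : trace_product (k :: l) = T k * trace_product l.
Proof. exact: big_cons. Qed.

Fixpoint dtrace_product (c d : 'I_n) (l : seq nat) : A :=
  if l is k :: l' then
    (M ^+ k.-1) d c *+ k * trace_product l' + T k * dtrace_product c d l'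
  else 0.

Lemma poly_deriv_trace_product (c d : 'I_n) l :
  poly_deriv (val c, val d) (trace_product l) (cst r * dtrace_product c d l).
Proof.
elim: l => [|k l IH] /=.
  by rewrite mulr0 /trace_product big_nil; exact: poly_deriv1.
rewrite trace_product_cons.
apply: (poly_deriv_eq (poly_derivM (poly_deriv_trace c d k) IH)) => //; ring.
Qed.

(** Contracting an extra factor [Tr (M ^ k.+1)] with the factor [Tr (M ^ m)] of
    a product merges both into [Tr (M ^ (k + m.-1))], in [m] ways; the pairs below
    list, for each factor in turn, this multiplicity and the resulting exponents. *)
Fixpoint merges (k : nat) (l : seq nat) : seq (nat * seq nat) :=
  if l is m :: l' then
    (m, (k + m.-1)%N :: l') :: [seq (x.1, m :: x.2) | x <- merges k l']
  else [::].

Lemma sum_dtrace_product k l :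
  \sum_b \sum_a (M ^+ k) b a * dtrace_product b a l =
  \sum_(x <- merges k l) trace_product x.2 *+ x.1.
Proof.
elim: l => [|m l IH] /=.
  by rewrite big_nil big1 // => b _; rewrite big1 // => a _; rewrite mulr0.
under eq_bigr => b _.
  under eq_bigr => a _ do rewrite mulrDr mulrA [_ * (T m * _)]mulrCA.
  rewrite big_split /= -mulr_suml -mulr_sumr.
  over.
rewrite big_split /= -mulr_suml -mulr_sumr IH big_cons big_map; congr (_ + _).
  rewrite trace_product_cons -mulrnAl; congr (_ * _).
  rewrite /T /trace_power /mxtrace -sumrMnl; apply: eq_bigr => b _.
  rewrite exprD -mulmxE mxE -sumrMnl; apply: eq_bigr => a _.
  by rewrite mulrnAr.
rewrite mulr_sumr; apply: eq_bigr => x _.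
by rewrite trace_product_cons mulrnAr.
Qed.

(** One entry of the first factor is integrated by parts.  Differentiating the rest
    of its own trace cuts this trace into two; differentiating another trace merges
    the two. *)
Lemma schwinger_dyson k l :
  E (T k.+1 * trace_product l) =
  r ^+ 2 * v * (\sum_(s < k) E (T s * T (k - s.+1) * trace_product l)
               + \sum_(x <- merges k l) E (trace_product x.2) *+ x.1).
Proof.
have -> : T k.+1 * trace_product l = \sum_b \sum_(a : 'I_n)
    cst r * (X (val a, val b) * ((M ^+ k) b a * trace_product l)).
  rewrite /T /trace_power /mxtrace exchange_big mulr_suml.
  apply: eq_bigr => a _ /=; rewrite exprS -mulmxE mxE mulr_suml.
  by apply: eq_bigr => b _; rewrite mxE; ring.
rewrite raddf_sum; under eq_bigr => b _ do rewrite raddf_sum.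
have H a b : E (cst r * (X (val a, val b) * ((M ^+ k) b a * trace_product l))) =
   r ^+ 2 * v * E ((\sum_(s < k) (M ^+ s) b b * (M ^+ (k - s.+1)) a a)
       * trace_product l + (M ^+ k) b a * dtrace_product b a l).
  rewrite Ecst.
  rewrite (integration_by_parts (p := (val a, val b)) (poly_derivM
    (poly_deriv_matrix_power b a k b a) (poly_deriv_trace_product b a l))).
  set D := \sum_(s < k) _.
  rewrite (_ : _ + _ = cst r * (D * trace_product l + (M ^+ k) b a * dtrace_product b a l)).
    by rewrite Ecst; ring.
  by ring.
under eq_bigr => b _ do under eq_bigr => a _ do rewrite H.
under eq_bigr => b _ do rewrite -mulr_sumr -raddf_sum.
rewrite -mulr_sumr -raddf_sum; congr (_ * _).
under [X in _ = _ + X]eq_bigr do rewrite -raddfMn.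
rewrite -!raddf_sum -raddfD /=; congr (E _).
under eq_bigr => b _ do rewrite big_split /=.
rewrite big_split /= sum_dtrace_product; congr (_ + _).
under eq_bigr => b _ do rewrite -mulr_suml.
rewrite -mulr_suml -mulr_suml; congr (_ * _).
under eq_bigr => b _ do rewrite exchange_big /=.
rewrite exchange_big; apply: eq_bigr => s _ /=.
rewrite /T /trace_power /mxtrace mulr_suml; apply: eq_bigr => b _.
by rewrite mulr_sumr.
Qed.

End traces.
End gaussian_integration_by_parts.

(** * Asymptotics of the mixed moments of the normalized traces *)

(** Convergence with an error O(1/n^2): this class of sequences contains all the
    expectations below, and its rate is the summable one that almost sure
    convergence needs. *)
Section inverse_square_rate.
Variable K : numFieldType.

Definition cvg_inverse_square (u : nat -> K) (c : K) : Prop :=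
  exists2 C : K, 0 <= C & forall n, (0 < n)%N -> `|u n - c| <= C / n%:R ^+ 2.

Lemma cvg_inverse_square_eq u u' c :
  cvg_inverse_square u c -> (forall n, (0 < n)%N -> u n = u' n) ->
  cvg_inverse_square u' c.
Proof. by move=> [C C0 hC] uu'; exists C => // n n0; rewrite -uu' // hC. Qed.

Lemma cvg_inverse_square_cst c : cvg_inverse_square (fun=> c) c.
Proof. by exists 0 => // n _; rewrite subrr normr0 mul0r. Qed.

Lemma cvg_inverse_squareD u a u' b :
  cvg_inverse_square u a -> cvg_inverse_square u' b ->
  cvg_inverse_square (fun n => u n + u' n) (a + b).
Proof.
move=> [C C0 hC] [D D0 hD]; exists (C + D); first exact: addr_ge0.
move=> n n0; rewrite opprD addrACA mulrDl.
by apply: (le_trans (ler_normD _ _)); rewrite lerD ?hC ?hD.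
Qed.

Lemma cvg_inverse_squareZ z u a : cvg_inverse_square u a ->
  cvg_inverse_square (fun n => z * u n) (z * a).
Proof.
move=> [C C0 hC]; exists (`|z| * C); first exact: mulr_ge0.
by move=> n n0; rewrite -mulrBr normrM -mulrA ler_wpM2l // hC.
Qed.

Lemma cvg_inverse_square_sum (I : eqType) (s : seq I) (u : I -> nat -> K) a :
  (forall i, i \in s -> cvg_inverse_square (u i) (a i)) ->
  cvg_inverse_square (fun n => \sum_(i <- s) u i n) (\sum_(i <- s) a i).
Proof.
elim: s => [|i s IH] h.
  apply: (cvg_inverse_square_eq (cvg_inverse_square_cst _)) => n _.
  by rewrite !big_nil.
have hs j : j \in s -> cvg_inverse_square (u j) (a j).
  by move=> js; apply: h; rewrite inE js orbT.
rewrite big_cons; apply: (cvg_inverse_square_eq (cvg_inverse_squareD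
  (h i (mem_head _ _)) (IH hs))).
by move=> n _; rewrite big_cons.
Qed.

Lemma cvg_inverse_square_div u a : cvg_inverse_square u a ->
  cvg_inverse_square (fun n => n%:R ^- 2 * u n) 0.
Proof.
move=> [C C0 hC]; exists (C + `|a|); first exact: addr_ge0.
move=> n n0; rewrite subr0 normrM ger0_norm ?invr_ge0 ?exprn_ge0 //.
rewrite mulrC ler_wpM2r ?invr_ge0 ?exprn_ge0 //.
rewrite -[u n](subrK a); apply: (le_trans (ler_normD _ _)); rewrite lerD2r.
apply: (le_trans (hC n n0)); rewrite ler_piMr //.
by rewrite invf_le1 ?exprn_ege1 ?exprn_gt0 ?ltr0n // ler1n.
Qed.

End inverse_square_rate.

Section moment_asymptotics.
Variables (K : numFieldType) (A : comPzRingType).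
Variables (cst : {rmorphism K -> A}) (E : {additive A -> K}).
Hypothesis Ecst : forall c x, E (cst c * x) = c * E x.
Hypothesis E1 : E 1 = 1.
Variables (X : nat * nat -> A) (v : K) (r m : nat -> K).
Hypothesis Wick : forall p L,
  E (X p * monomial X L) = v * E (dmonomial X (transpose p) L).
Hypothesis r2 : forall n, (0 < n)%N -> r n ^+ 2 = n%:R^-1.
Hypothesis m0 : m 0%N = 1.
Hypothesis mS : forall k, m k.+1 = v * \sum_(s < k) m s * m (k - s.+1)%N.

Definition normalized_trace n k : A :=
  cst n%:R^-1 * trace_power cst X n (r n) k.

Lemma prod_normalized_trace n l : \prod_(k <- l) normalized_trace n k =
  cst (n%:R ^- size l) * trace_product cst X n (r n) l.
Proof.
elim: l => [|k l IH]; first by rewrite big_nil invr1 rmorph1 mul1r /trace_product big_nil.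
rewrite big_cons IH trace_product_cons /normalized_trace exprS invfM rmorphM.
by ring.
Qed.

Lemma normalized_trace0 n : (0 < n)%N -> normalized_trace n 0 = 1.
Proof.
move=> n0; rewrite /normalized_trace /trace_power expr0 mxtrace1.
rewrite -(rmorph_nat cst) -rmorphM mulVf ?rmorph1 //.
by rewrite pnatr_eq0 -lt0n.
Qed.

(** The contraction contributes a factor [1 / n].  Cutting produces one more trace,
    which this factor normalizes; merging leaves one trace fewer, hence the excess
    factor [1 / n ^ 2]. *)
Lemma normalized_schwinger_dyson n k l : (0 < n)%N ->
  E (\prod_(j <- k.+1 :: l) normalized_trace n j) =
  v * (\sum_(s < k) E (\prod_(j <- [:: val s, (k - s.+1)%N & l]) normalized_trace n j)
      + n%:R ^- 2 * \sum_(x <- merges k l)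
           x.1%:R * E (\prod_(j <- x.2) normalized_trace n j)).
Proof.
move=> n0; have n0' : n%:R != 0 :> K by rewrite pnatr_eq0 -lt0n.
rewrite prod_normalized_trace Ecst trace_product_cons.
rewrite (schwinger_dyson Ecst Wick) r2 // mulrDr mulrDr mulrDr !mulr_sumr.
have sz x : x \in merges k l -> size x.2 = size l.
  elim: l x => //= a l IH x; rewrite inE => /predU1P[->//|/mapP[y /IH <- ->]//].
congr (_ + _).
  apply: eq_bigr => s _; rewrite prod_normalized_trace Ecst !trace_product_cons /=.
  by rewrite -(mulrA (trace_power _ _ _ _ s)) !exprS !invfM; ring.
rewrite big_seq [RHS]big_seq; apply: eq_bigr => x /sz hx.
rewrite prod_normalized_trace Ecst hx -mulr_natl /= exprS expr2 !invfM; ring.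
Qed.

(** The terms on the right of the normalized identity have smaller total degree
    or fewer factors; so one induction gives both the limits of the expected
    traces and the decay of their covariances. *)
Lemma mixed_moment_asymptotics l :
  cvg_inverse_square (fun n => E (\prod_(k <- l) normalized_trace n k))
    (\prod_(k <- l) m k).
Proof.
have [N] := ubnP (sumn l + size l)%N.
elim: N l => // N IH [|[|k] l] hl.
- rewrite big_nil; apply: (cvg_inverse_square_eq (cvg_inverse_square_cst 1)).
  by move=> n _; rewrite big_nil E1.
- rewrite big_cons m0 mul1r; apply: (cvg_inverse_square_eq (IH l _)).
    by move: hl; rewrite /=; lia.
  by move=> n n0; rewrite big_cons normalized_trace0 // mul1r.
have {}hl : (k + sumn l + size l + 1 < N)%N by move: hl => /=; lia.
have lim1 : cvg_inverse_square (fun n => \sum_(s < k)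
      E (\prod_(j <- [:: val s, (k - s.+1)%N & l]) normalized_trace n j))
    (\sum_(s < k) m s * m (k - s.+1)%N * \prod_(j <- l) m j).
  apply: cvg_inverse_square_sum => s _.
  have := IH [:: val s, (k - s.+1)%N & l].
  by rewrite !big_cons mulrA; apply => /=; have := ltn_ord s; lia.
have lim2 : cvg_inverse_square (fun n => n%:R ^- 2 * \sum_(x <- merges k l)
    x.1%:R * E (\prod_(j <- x.2) normalized_trace n j)) 0.
  apply: (cvg_inverse_square_div
    (a := \sum_(x <- merges k l) x.1%:R * \prod_(j <- x.2) m j)).
  apply: cvg_inverse_square_sum => x xl; have [->|x0] := eqVneq x.1 0%N.
    apply: (cvg_inverse_square_eq (cvg_inverse_square_cst _)) => n _.
    by rewrite !mul0r.
  apply: cvg_inverse_squareZ; apply: IH.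
  apply: (@leq_ltn_trans (k + sumn l + size l)); last by lia.
  elim: l x xl x0 {hl lim1} => // a l IHl x /=; rewrite inE => /predU1P[->/=|]; first by lia.
  move=> /mapP[y yl ->] /= /(IHl _ yl). lia.
rewrite big_cons mS -mulrA mulr_suml -[X in v * X]addr0.
apply: (cvg_inverse_square_eq
  (cvg_inverse_squareZ v (cvg_inverse_squareD lim1 lim2))) => n n0.
by rewrite -normalized_schwinger_dyson.
Qed.

End moment_asymptotics.
(** * Integration against a measure with a density *)

(** Both sides are the difference of the integrals of the positive and the negative
    part, and for nonnegative functions the identity passes from indicators to
    increasing limits of simple functions. *)
Section density.
Context d (T : measurableType d) (R : realType).
Variables (mu nu : {measure set T -> \bar R}) (D : set T) (g : T -> R).
Hypotheses (mD : measurable D) (mg : measurable_fun [set: T] g).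
Hypothesis g0 : forall x, 0 <= g x.
Hypothesis nuE : forall B, measurable B ->
  nu B = (\int[mu]_(x in B `&` D) (g x)%:E)%E.

Import HBNNSimple.

Let integral_density_indic B : measurable B ->
  (\int[nu]_x (\1_B x)%:E = \int[mu]_(x in D) ((\1_B x)%:E * (g x)%:E))%E.
Proof.
move=> mB; rewrite integral_indic//= setIT nuE// integral_mkcondl.
apply: eq_integral => x _; rewrite patchE indicE.
by case: (x \in B); rewrite ?mul1e ?mul0e.
Qed.

Let mgE A : measurable_fun A (fun x => (g x)%:E).
Proof. by apply/measurable_EFinP; exact: measurable_funTS. Qed.

Let integral_density_nnsfun (f : {nnsfun T >-> R}) :
  (\int[nu]_x (f x)%:E = \int[mu]_(x in D) ((f x)%:E * (g x)%:E))%E.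
Proof.
under [LHS]eq_integral do rewrite fimfunE -fsumEFin//.
rewrite [LHS]ge0_integral_fsum//; last 2 first.
  - by move=> r; exact/measurable_EFinP/measurableT_comp.
  - by move=> n x _; rewrite EFinM nnfun_muleindic_ge0.
under [RHS]eq_integral.
  move=> x xD; rewrite fimfunE -fsumEFin// ge0_mule_fsuml; last first.
    by move=> r; rewrite EFinM nnfun_muleindic_ge0.
  over.
rewrite [RHS]ge0_integral_fsum//; last 2 first.
  - move=> r; apply: emeasurable_funM => //.
    by apply/measurable_EFinP; apply: measurable_funTS; exact/measurableT_comp.
  - by move=> n x _; rewrite mule_ge0 ?lee_fin// -lee_fin EFinM nnfun_muleindic_ge0.
apply: eq_fsbigr => r _.
under [RHS]eq_integral do rewrite EFinM -muleA.
rewrite integralZl_indic_nnsfun//= integral_density_indic//.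
case: (leP 0 r) => [r0|r0].
  rewrite ge0_integralZl//.
  - by apply: emeasurable_funM => //; apply/measurable_EFinP; exact: measurable_funTS.
  - by move=> x _; rewrite mule_ge0 ?lee_fin.
rewrite (preimage_nnfun0 _ r0).
under [X in (_ * X)%E]eq_integral do rewrite indicE in_set0 mul0e.
under [RHS]eq_integral do rewrite indicE in_set0 mul0e mule0.
by rewrite !integral0 mule0.
Qed.

Let ge0_integral_density (f : T -> \bar R) :
  measurable_fun setT f -> (forall x, 0 <= f x)%E ->
  (\int[nu]_x f x = \int[mu]_(x in D) (f x * (g x)%:E))%E.
Proof.
move=> mf f0.
pose f_ := nnsfun_approx measurableT mf.
have cvgf x : (f_ n x)%:E @[n --> \oo] --> f x by exact: cvg_nnsfun_approx.
transitivity (lim (\int[nu]_x (f_ n x)%:E @[n --> \oo])%E).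
  rewrite -monotone_convergence//=.
  - by apply: eq_integral => x _; apply/esym/cvg_lim => //=; exact: cvgf.
  - by move=> n; exact/measurable_EFinP/measurable_funTS.
  - by move=> n ? _; rewrite lee_fin.
  - by move=> ? _ ? ? mn; rewrite lee_fin; exact/lefP/nd_nnsfun_approx.
under eq_fun do rewrite integral_density_nnsfun.
rewrite -monotone_convergence//=.
- apply: eq_integral => x _; apply/cvg_lim => //=.
  by apply: cvgeZr => //; exact: cvgf.
- move=> n; apply: emeasurable_funM => //.
  by apply/measurable_EFinP; exact: measurable_funTS.
- by move=> n x _; rewrite mule_ge0 ?lee_fin.
- move=> x _ m n mn; rewrite lee_wpmul2r ?lee_fin//.
  exact/lefP/nd_nnsfun_approx.
Qed.

Lemma integral_density (f : T -> \bar R) : measurable_fun setT f ->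
  (\int[nu]_x f x = \int[mu]_(x in D) (f x * (g x)%:E))%E.
Proof.
move=> mf; rewrite integralE [RHS]integralE.
rewrite !ge0_integral_density//; first last.
- exact: measurable_funepos.
- exact: measurable_funeneg.
congr (_ - _)%E; apply: eq_integral => x _; rewrite ?funeposE ?funenegE.
  by rewrite maxe_pMl ?lee_fin ?g0// mul0e.
by rewrite maxe_pMl ?lee_fin ?g0// mul0e mulNe.
Qed.

End density.

(** * Moments of the semicircle law *)

Section calculus.
Variable R : realType.
Local Notation mu := (@lebesgue_measure R).

Lemma continuous_sub (f g : R -> R) :
  continuous f -> continuous g -> continuous (fun x => f x - g x).
Proof. by move=> cf cg x; exact: (continuousB (cf x) (cg x)). Qed.

Lemma continuous_add (f g : R -> R) :
  continuous f -> continuous g -> continuous (fun x => f x + g x).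
Proof. by move=> cf cg x; exact: (continuousD (cf x) (cg x)). Qed.

Lemma continuous_mul (f g : R -> R) :
  continuous f -> continuous g -> continuous (fun x => f x * g x).
Proof. by move=> cf cg x; exact: (continuousM (cf x) (cg x)). Qed.

Lemma continuous_const (c : R) : continuous (fun _ : R => c).
Proof. by move=> x; exact: cvg_cst. Qed.

Lemma continuous_X k : continuous (fun x : R => x ^+ k).
Proof. exact: exprn_continuous. Qed.

Lemma integral_derivative (f F : R -> R) (a b : R) : a < b ->
  continuous f -> continuous F ->
  (forall x, x \in `]a, b[ -> is_derive x 1 F (f x)) ->
  (\int[mu]_(x in `[a, b]) (f x)%:E)%E = (F b - F a)%:E.
Proof.
move=> ab cf cF dF.
rewrite (continuous_FTC2 ab (F := F)) ?EFinB //.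
- exact: continuous_subspaceT.
- split; [by move=> x /dF []| |].
  + by apply: cvg_at_right_filter; exact: cF.
  + by apply: cvg_at_left_filter; exact: cF.
- by move=> x /dF dFx; rewrite derive1E derive_val.
Qed.

Lemma Rintegral_derivative (f F : R -> R) (a b : R) : a < b ->
  continuous f -> continuous F ->
  (forall x, x \in `]a, b[ -> is_derive x 1 F (f x)) ->
  \int[mu]_(x in `[a, b]) f x = F b - F a.
Proof. by move=> ab cf cF dF; rewrite /Rintegral (integral_derivative ab cf cF dF). Qed.

Lemma continuous_integrable_segment (f : R -> R) (a b : R) : continuous f ->
  mu.-integrable `[a, b] (EFin \o f).
Proof.
move=> cf; apply: continuous_compact_integrable; first exact: segment_compact.
exact: continuous_subspaceT.
Qed.

End calculus.

Section semicircle_moments.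
Variables (R : realType) (a : R).
Hypothesis a_gt0 : 0 < a.
Local Notation mu := (@lebesgue_measure R).

Let q (x : R) : R := Num.sqrt (a ^+ 2 - x ^+ 2).

Definition halfdisc_moment k : R := \int[mu]_(x in `[- a, a]) (x ^+ k * q x).
Local Notation I := halfdisc_moment.

Let Naa : - a < a. Proof. by rewrite gtrN. Qed.

Let cq : continuous q.
Proof.
move=> x; apply: (cvg_comp (fun x => a ^+ 2 - x ^+ 2) Num.sqrt).
  move: x; apply: continuous_sub; [exact: continuous_const | exact: continuous_X].
exact: sqrt_continuous.
Qed.

Let cXq k : continuous (fun x : R => x ^+ k * q x).
Proof. by apply: continuous_mul; [exact: continuous_X | exact: cq]. Qed.

Let q2 x : x \in `[- a, a] -> q x ^+ 2 = a ^+ 2 - x ^+ 2.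
Proof.
rewrite in_itv /= => /andP[h1 h2]; rewrite sqr_sqrtr // subr_sqr.
by rewrite mulr_ge0 //; lra.
Qed.

Let q_gt0 x : x \in `]- a, a[ -> 0 < a ^+ 2 - x ^+ 2.
Proof.
by rewrite in_itv /= => /andP[h1 h2]; rewrite subr_sqr mulr_gt0 //; lra.
Qed.

Let cZ (c : R) (g : R -> R) : continuous g -> continuous (fun x : R => c * g x).
Proof. by apply: continuous_mul; exact: continuous_const. Qed.

Let dsub (x : R) : is_derive x 1 (fun y : R => a ^+ 2 - y ^+ 2) (- (2 * x)).
Proof. apply: is_derive_eq; rewrite /GRing.scale /=; ring. Qed.

Let dq x : x \in `]- a, a[ -> is_derive x 1 q (- x / q x).
Proof.
move=> /q_gt0 h.
have := @is_derive1_comp _ Num.sqrt (fun y : R => a ^+ 2 - y ^+ 2) x _ _ (is_derive1_sqrt h) (dsub x).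
move=> /is_derive_eq; apply.
rewrite invfM -/(q x); field.
by rewrite /q sqrtr_eq0 -ltNge.
Qed.

(** The relation of consecutive moments is the vanishing of the integral of the
    derivative of [x ^+ k * (a ^+ 2 - x ^+ 2) * q x], which is 0 at both ends. *)
Lemma halfdisc_moment_derivative k :
  k%:R * (a ^+ 2 * I k.-1) = (k + 3)%:R * I k.+1.
Proof.
pose F x := x ^+ k * ((a ^+ 2 - x ^+ 2) * q x).
pose f x := (k%:R * a ^+ 2) * (x ^+ k.-1 * q x) - (k + 3)%:R * (x ^+ k.+1 * q x).
have cf : continuous f.
  by apply: continuous_sub; apply: cZ; exact: cXq.
have cF : continuous F.
  apply: continuous_mul; first exact: continuous_X.
  apply: continuous_mul; last exact: cq.
  by apply: continuous_sub; [exact: continuous_const | exact: continuous_X].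
have dF x : x \in `]- a, a[ -> is_derive x 1 F (f x).
  move=> hx; have dqx := dq hx.
  have hq : q x != 0 by rewrite /q sqrtr_eq0 -ltNge q_gt0.
  have dX : is_derive x 1 (fun y : R => y ^+ k) (k%:R * x ^+ k.-1).
    have := is_deriveX k (is_derive_id x 1); rewrite exprfctE => /is_derive_eq.
    by apply; rewrite /GRing.scale /= mulr1.
  have := is_deriveM dX (is_deriveM (dsub x) dqx) => /is_derive_eq; apply.
  have e : (a ^+ 2 - x ^+ 2) * (- x / q x) = - x * q x.
    by rewrite -q2 ?subset_itv_oo_cc //; field.
  rewrite /f /GRing.scale /= e natrD mulrfctE /=; case: (k) => [|j] /=; first ring.
  rewrite [x ^+ j.+2]exprS ![x ^+ j.+1]exprS; ring.
have : \int[mu]_(x in `[- a, a]) f x = 0.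
  rewrite (Rintegral_derivative Naa cf cF dF) /F sqrrN subrr !mul0r !mulr0.
  exact: subrr.
rewrite /f RintegralB //; last 2 first.
- by apply: continuous_integrable_segment; apply: cZ; exact: cXq.
- by apply: continuous_integrable_segment; apply: cZ; exact: cXq.
rewrite !RintegralZl //; try exact: continuous_integrable_segment.
by move=> /eqP; rewrite subr_eq0 mulrA => /eqP.
Qed.

(** The substitution [x = a * sin t] makes the primitive elementary and smooth at
    both ends. *)
Lemma halfdisc_moment0 : I 0 = pi * a ^+ 2 / 2.
Proof.
have pi2 : - (pi / 2) < pi / 2 :> R by have := pi_gt0 R; lra.
pose F (t : R) := a * sin t.
have dF (t : R) : is_derive t 1 F (a * cos t).
  by apply: is_derive_eq; rewrite /GRing.scale /=; ring.
have F'E : (F^`())%classic = fun t => a * cos t.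
  by apply/funext => t; rewrite derive1E derive_val.
have cF : continuous F by apply: cZ; exact: continuous_sin.
have cF' : continuous (fun t : R => a * cos t) by apply: cZ; exact: continuous_cos.
have Fr : F (pi / 2) = a by rewrite /F sin_pihalf mulr1.
have Fl : F (- (pi / 2)) = - a by rewrite /F sinN sin_pihalf mulrN mulr1.
have homF : {in `[- (pi / 2), pi / 2] &, {homo F : x y / x < y}}.
  by move=> x y hx hy xy; rewrite ltr_pM2l // ltr_sin.
rewrite /halfdisc_moment /Rintegral.
under eq_integral do rewrite expr0 mul1r.
have := integration_by_substitution_increasing (G := q) (ltW pi2) homF.
rewrite F'E Fr Fl => ->; last 5 first.
- by move=> x _; exact: cF'.
- by apply/cvg_ex; exists (a * cos (- (pi / 2))); apply: cvg_at_right_filter; exact: cF'.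
- by apply/cvg_ex; exists (a * cos (pi / 2)); apply: cvg_at_left_filter; exact: cF'.
- split=> [x _| |]; first by have [] := dF x.
  + by apply: cvg_at_right_filter; exact: cF.
  + by apply: cvg_at_left_filter; exact: cF.
- by apply: continuous_subspaceT; exact: cq.
have E t : t \in `[- (pi / 2), pi / 2] -> q (F t) * (a * cos t) = a ^+ 2 * cos t ^+ 2.
  move=> ht; rewrite /q /F (_ : a ^+ 2 - _ = (a * cos t) ^+ 2); last first.
    rewrite !exprMn (cos2sin2 t); ring.
  rewrite sqrtr_sqr ger0_norm ?exprMn; last first.
    by rewrite mulr_ge0 ?(ltW a_gt0) // cos_ge0_pihalf.
  ring.
transitivity (fine (\int[mu]_(t in `[- (pi / 2), pi / 2])
    (a ^+ 2 * (cos t * cos t))%:E)).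
  congr fine; apply: eq_integral => t; rewrite inE /= => ht.
  by rewrite mulrfctE /= E // expr2.
pose G (t : R) := a ^+ 2 / 2 * (t + sin t * cos t).
have cg : continuous (fun t : R => a ^+ 2 * (cos t * cos t)).
  by apply: cZ; apply: continuous_mul; exact: continuous_cos.
have cG : continuous G.
  apply: cZ; apply: continuous_add; first by move=> t; exact: cvg_id.
  by apply: continuous_mul; [exact: continuous_sin | exact: continuous_cos].
have dG t : t \in `]- (pi / 2), pi / 2[ -> is_derive t 1 G (a ^+ 2 * (cos t * cos t)).
  move=> _; apply: is_derive_eq; rewrite /GRing.scale /=.
  have := sin2cos2 t; rewrite !expr2 => sc.
  by rewrite mulrN sc; field.
rewrite (integral_derivative pi2 cg cG dG) /= /G.
by rewrite cosN cos_pihalf; field.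
Qed.

End semicircle_moments.

(** The recursion obeyed by the moments of the semicircle law turns into the
    convolution identity of the Catalan numbers: with [S k] the convolution sum,
    symmetry gives [2 * \sum_s s * m s * m (k - s) = k * S k], and expressing
    [(s + 4) * m s.+2] through [m s] reduces [S k.+2] to [S k]. *)
Section catalan_convolution.
Variables (K : numFieldType) (v : K) (m : nat -> K).
Hypothesis m0 : m 0%N = 1.
Hypothesis m1 : m 1%N = 0.
Hypothesis mSS : forall k, (k + 4)%:R * m k.+2 = (k + 1)%:R * (4 * v) * m k.

Let S k := \sum_(s < k.+1) m s * m (k - s)%N.

Let weighted_sum k : 2 * \sum_(s < k.+1) s%:R * (m s * m (k - s)%N) = k%:R * S k.
Proof.
rewrite mulr_natl mulr2n {1}(reindex_inj rev_ord_inj) /= -big_split /= mulr_sumr.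
apply: eq_bigr => s _; have sk : (s <= k)%N by rewrite -ltnS.
by rewrite subSS subKn // [m (k - s)%N * _]mulrC -mulrDl -natrD subnK.
Qed.

Let convolution k : m k.+2 = v * S k.
Proof.
have [N] := ubnP k; elim: N k => // N IH [|[|k]] hk.
- have n4 : 4 != 0 :> K by rewrite pnatr_eq0.
  apply: (mulfI n4); rewrite /S big_ord1 m0 !mulr1.
  by have := mSS 0; rewrite m0 mulr1 mul1r.
- have := mSS 1; rewrite /S !big_ord_recl big_ord0 /= m1 ?mulr0 ?mul0r ?addr0 ?mulr0.
  by move=> /eqP; rewrite mulf_eq0 pnatr_eq0 /= => /eqP.
have k6 : (k.+2 + 4)%:R != 0 :> K by rewrite pnatr_eq0.
apply: (mulfI k6); rewrite mSS.
have H1 : (k.+2 + 4)%:R * S k.+2 =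
    2 * \sum_(s < k.+3) (s + 2)%:R * (m s * m (k.+2 - s)%N).
  under eq_bigr do rewrite natrD mulrDl.
  by rewrite big_split /= mulrDr weighted_sum -mulr_sumr -/(S k.+2); ring.
have H2 : \sum_(s < k.+3) (s + 2)%:R * (m s * m (k.+2 - s)%N) =
    2 * m k.+2 + 4 * v * \sum_(s < k.+1) (s + 1)%:R * (m s * m (k - s)%N).
  rewrite 2!big_ord_recl /= m0 m1 mul0r mulr0 add0r mul1r subn0; congr (_ + _).
  rewrite mulr_sumr; apply: eq_bigr => s _; rewrite /bump /= !add1n !subSS.
  have := mSS s; rewrite (_ : (s.+2 + 2)%N = (s + 4)%N); last by lia.
  by move=> e; rewrite mulrA e; ring.
have H3 : 2 * \sum_(s < k.+1) (s + 1)%:R * (m s * m (k - s)%N) = (k + 2)%:R * S k.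
  under eq_bigr do rewrite natrD mulrDl.
  by rewrite big_split /= mulrDr weighted_sum -mulr_sumr -/(S k); ring.
have H4 : m k.+2 = v * S k by apply: IH; lia.
rewrite [RHS]mulrCA H1 H2 mulrDr [2 * (4 * v * _)]mulrCA H3.
rewrite (_ : 4 * v * ((k + 2)%:R * S k) = 4 * (k + 2)%:R * m k.+2); last first.
  by rewrite H4; ring.
ring.
Qed.

Lemma catalan_convolution k : m k.+1 = v * \sum_(s < k) m s * m (k - s.+1)%N.
Proof.
case: k => [|k]; first by rewrite big_ord0 mulr0.
by rewrite convolution; congr (_ * _); apply: eq_bigr => s _; rewrite subSS.
Qed.

End catalan_convolution.

Section semicircle_law.
Variables (R : realType) (w : R).
Hypothesis w_gt0 : 0 < w.
Local Notation mu := (@lebesgue_measure R).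

Definition semicircle_radius : R := 2 * Num.sqrt 2 * w.
Local Notation a := semicircle_radius.

Lemma semicircle_radius_gt0 : 0 < a.
Proof. by rewrite !mulr_gt0 // sqrtr_gt0. Qed.

Lemma semicircle_radius_sqr : a ^+ 2 = 8 * w ^+ 2.
Proof. by rewrite !exprMn sqr_sqrtr //; ring. Qed.

Definition semicircle_moment k : R :=
  (4 * pi * w ^+ 2)^-1 * halfdisc_moment a k.
Local Notation m := semicircle_moment.

Lemma semicircle_moment0 : m 0 = 1.
Proof.
rewrite /semicircle_moment halfdisc_moment0 ?semicircle_radius_gt0 // semicircle_radius_sqr.
move: (pi) (pi_gt0 R) => p p0.
by field; rewrite (gt_eqF w_gt0) (gt_eqF p0).
Qed.

Lemma semicircle_moment1 : m 1 = 0.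
Proof.
have := halfdisc_moment_derivative semicircle_radius_gt0 0.
rewrite mul0r => /esym/eqP; rewrite mulf_eq0 pnatr_eq0 /= => /eqP h.
by rewrite /semicircle_moment h mulr0.
Qed.

Lemma semicircle_momentSS k :
  (k + 4)%:R * m k.+2 = (k + 1)%:R * a ^+ 2 * m k.
Proof.
have /= := halfdisc_moment_derivative semicircle_radius_gt0 k.+1.
rewrite /semicircle_moment (_ : (k.+1 + 3)%N = (k + 4)%N); last by lia.
by rewrite addn1 => h; rewrite mulrCA -h; ring.
Qed.

Lemma semicircle_moment_convolution k :
  m k.+1 = 2 * w ^+ 2 * \sum_(s < k) m s * m (k - s.+1)%N.
Proof.
apply: (catalan_convolution semicircle_moment0 semicircle_moment1) => j.
by rewrite semicircle_momentSS semicircle_radius_sqr; ring.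
Qed.

(** The growth of the even moments is that of the radius; it makes the mass that
    the empirical measures put outside a larger segment negligible. *)
Lemma semicircle_moment_even_bound k : 0 <= m k.*2 <= a ^+ k.*2.
Proof.
elim: k => [|k /andP[m0 ma]]; first by rewrite semicircle_moment0 ler01 lexx.
have h4 : 0 < (k.*2 + 4)%:R :> R by rewrite ltr0n addn4.
have a2 : 0 <= a ^+ 2 by exact: sqr_ge0.
have e : m k.*2.+2 = (k.*2 + 1)%:R / (k.*2 + 4)%:R * (a ^+ 2 * m k.*2).
  apply: (mulfI (lt0r_neq0 h4)); rewrite semicircle_momentSS.
  by move: (_ + 4)%:R (lt0r_neq0 h4) => D D0; field.
rewrite doubleS e; apply/andP; split.
  by apply: mulr_ge0; [apply: divr_ge0 | apply: mulr_ge0].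
apply: (@le_trans _ _ (a ^+ 2 * m k.*2)).
  apply: ler_piMl; first exact: mulr_ge0.
  by rewrite ler_pdivrMr // mul1r ler_nat leq_add2l.
by rewrite (exprD a 2 k.*2 : a ^+ k.*2.+2 = _) ler_wpM2l.
Qed.

Lemma integral_semicircle (f : R -> R) : continuous f ->
  (\int[semicircle w]_x (f x)%:E =
   (\int[mu]_(x in `[- a, a]) (f x * semicircle_pdf w x))%:E)%E.
Proof.
move=> cf.
rewrite (@integral_density _ _ R mu (semicircle w) `[- a, a]%classic
  (semicircle_pdf w)) //; first last.
- by apply/measurable_EFinP; exact: continuous_measurable_fun.
- exact: semicircle_pdf_ge0.
- exact: measurable_semicircle_pdf.
have cfp : continuous (fun x => f x * semicircle_pdf w x).
  by apply: continuous_mul => //; exact: continuous_semicircle_pdf.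
rewrite /Rintegral fineK //.
exact: (integrable_fin_num _ (continuous_integrable_segment (- a) a cfp)).
Qed.

Lemma integral_semicircleX k :
  (\int[semicircle w]_x (x ^+ k)%:E = (m k)%:E)%E.
Proof.
rewrite integral_semicircle; last exact: exprn_continuous.
congr EFin; rewrite /semicircle_moment /halfdisc_moment -RintegralZl //.
  apply: eq_Rintegral => x _; rewrite /semicircle_pdf semicircle_radius_sqr; ring.
apply: continuous_integrable_segment.
apply: continuous_mul; first exact: continuous_X.
move=> x; apply: (cvg_comp (fun x => a ^+ 2 - x ^+ 2) Num.sqrt).
  move: x; apply: continuous_sub; [exact: continuous_const | exact: continuous_X].
exact: sqrt_continuous.
Qed.

End semicircle_law.

(** * Polynomial approximation *)

Section weierstrass.
Variable R : realType.

(** Compactness is used through near coverings: the modulus [d] tends to 0 along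
    the filter of right neighbourhoods. *)
Lemma segment_unif_continuous (f : R -> R) (a b e : R) : continuous f -> 0 < e ->
  exists2 d : R, 0 < d & forall x, x \in `[a, b] -> forall y,
    `|x - y| < d -> `|f x - f y| < e.
Proof.
move=> cf e0.
have /compact_near_coveringP H := @segment_compact R a b.
have e20 : 0 < e / 2 by rewrite divr_gt0.
have := H R (0^'+) (fun d x => forall y, `|x - y| < d -> `|f x - f y| < e) _ _.
case.
- move=> x _.
  have /cvgrPdist_lt /(_ _ e20) /nbhs_ballP [d /= d0 hd] := cf x.
  have d20 : 0 < d / 2 by rewrite divr_gt0.
  exists (ball x (d / 2), [set d' | d' < d / 2]).
    split => /=; first exact: nbhsx_ballx.
    exact: nbhs_right_lt.
  move=> [x' d'] /= [xx' d'2] y x'y.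
  have h1 := hd x' (le_ball _ xx').
  have h2 : `|f x - f y| < e / 2.
    apply: hd; rewrite /ball /=; move: xx'; rewrite /ball /=.
    have := ler_distD x' x y; lra.
  have h1' : `|f x - f x'| < e / 2 by apply: h1; lra.
  have := ler_distD (f x) (f x') (f y); rewrite (distrC (f x') (f x)); lra.
- move=> d /= d0 hd.
  exists (d / 2); first by rewrite divr_gt0.
  move=> x xab y xy; apply: (hd (d / 2)) => //=.
  + by rewrite sub0r normrN gtr0_norm ?divr_gt0 //; lra.
  + by rewrite divr_gt0.
Qed.

(** The Bernstein operator: the value at [x] of [bernstein n phi] is the mean of
    [phi] under the binomial law with parameters [n] and [x]; the recursion
    conditions on one of the [n] trials. *)
Fixpoint bernstein (n : nat) (phi : nat -> R) : {poly R} :=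
  if n is n'.+1 then
    'X * bernstein n' (fun k => phi k.+1) + (1 - 'X) * bernstein n' phi
  else (phi 0%N)%:P.

Lemma bernsteinS n phi x : (bernstein n.+1 phi).[x] =
  x * (bernstein n (fun k => phi k.+1)).[x] + (1 - x) * (bernstein n phi).[x].
Proof. by rewrite /= !hornerE. Qed.

Lemma bernsteinD n phi psi x : (bernstein n (fun k => phi k + psi k)).[x] =
  (bernstein n phi).[x] + (bernstein n psi).[x].
Proof.
elim: n phi psi => [|n IH] phi psi; first by rewrite /= !hornerC.
by rewrite !bernsteinS !IH; ring.
Qed.

Lemma bernsteinZ n c phi x :
  (bernstein n (fun k => c * phi k)).[x] = c * (bernstein n phi).[x].
Proof.
elim: n phi => [|n IH] phi; first by rewrite /= !hornerC.
by rewrite !bernsteinS !IH; ring.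
Qed.

Lemma bernstein_cst n c x : (bernstein n (fun=> c)).[x] = c.
Proof.
elim: n => [|n IH]; first by rewrite /= hornerC.
by rewrite bernsteinS !IH; ring.
Qed.

Lemma bernstein_variance n c x : (bernstein n (fun k => (k%:R - c) ^+ 2)).[x] =
  n%:R * x * (1 - x) + (n%:R * x - c) ^+ 2.
Proof.
elim: n c => [|n IH] c; first by rewrite /= hornerC; ring.
rewrite bernsteinS IH.
have -> : (fun k => (k.+1%:R - c) ^+ 2) = (fun k => (k%:R - (c - 1)) ^+ 2) :> (nat -> R).
  by apply/funext => k; rewrite -natr1; ring.
by rewrite IH -natr1; ring.
Qed.

Lemma le_bernstein n phi psi x : 0 <= x <= 1 ->
  (forall k, (k <= n)%N -> phi k <= psi k) ->
  (bernstein n phi).[x] <= (bernstein n psi).[x].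
Proof.
move=> /andP[x0 x1]; elim: n phi psi => [|n IH] phi psi h.
  by rewrite /= !hornerC h.
rewrite !bernsteinS lerD // ler_wpM2l ?subr_ge0 // IH // => k kn; apply: h => //.
exact: leqW.
Qed.

(** On a compact segment, [g] varies by at most [e / 2 + M * (x - y) ^+ 2]; the
    Bernstein operator is monotone, so that the variance of the binomial law bounds
    the error. *)
Let weierstrass01 (g : R -> R) (e : R) : continuous g -> 0 < e ->
  exists p : {poly R}, forall x, 0 <= x <= 1 -> `|g x - p.[x]| <= e.
Proof.
move=> cg e0; have e20 : 0 < e / 2 by rewrite divr_gt0.
have [d d0 hd] := segment_unif_continuous 0 1 cg e20.
have [C C0 hC] : exists2 C : R, 0 <= C & forall x, 0 <= x <= 1 -> `|g x| <= C.
  have [|c _ hc] := @EVT_max R (fun x => `|g x|) 0 1 ler01.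
    apply: continuous_subspaceT => x; apply: (cvg_comp g Num.norm (cg x)).
    exact: norm_continuous.
  by exists `|g c| => // x x01; apply: hc; rewrite in_itv.
pose M := 2 * C / d ^+ 2.
have M0 : 0 <= M by rewrite divr_ge0 ?exprn_ge0 ?mulr_ge0 // ltW.
have hM x y : 0 <= x <= 1 -> 0 <= y <= 1 -> `|g x - g y| <= e / 2 + M * (x - y) ^+ 2.
  move=> hx hy; have [xy|xy] := ltP `|x - y| d.
    apply: (le_trans (ltW (hd x _ y xy))); first by rewrite in_itv.
    by rewrite lerDl mulr_ge0 // sqr_ge0.
  apply: (@le_trans _ _ (2 * C)).
    by apply: (le_trans (ler_normB _ _)); have := hC x hx; have := hC y hy; lra.
  have dxy : d ^+ 2 <= (x - y) ^+ 2.
    by rewrite -[leRHS]real_normK ?num_real // lerXn2r // nnegrE // ltW.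
  have -> : 2 * C = M * d ^+ 2 by rewrite /M divfK // expf_neq0 // gt_eqF.
  by rewrite -[leLHS]add0r lerD ?ler_wpM2l // ltW.
pose n := (Num.truncn (2 * M / e)).+1.
have n0 : 0 < n%:R :> R by rewrite ltr0n.
have Mn : M / n%:R <= e / 2.
  have : 2 * M / e < n%:R by exact: truncnS_gt.
  by rewrite ltr_pdivrMr // ler_pdivrMr //; move: n%:R => N; lra.
exists (bernstein n (fun k => g (k%:R / n%:R))) => x hx.
have kn k : (k <= n)%N -> 0 <= (k%:R / n%:R : R) <= 1.
  by move=> kn; rewrite divr_ge0 //= ler_pdivrMr // mul1r ler_nat.
pose dev k := e / 2 + M / n%:R ^+ 2 * (k%:R - n%:R * x) ^+ 2.
have hdev : (bernstein n dev).[x] <= e.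
  rewrite bernsteinD bernstein_cst bernsteinZ bernstein_variance subrr expr0n addr0 /=.
  rewrite [e in leRHS]splitr lerD2l.
  rewrite (_ : _ * _ = M / n%:R * (x * (1 - x))); last by field; rewrite gt_eqF.
  apply: le_trans Mn; apply: ler_piMr; first by rewrite divr_ge0 // ltW.
  by case/andP: hx => x0 x1; apply: mulr_ile1; lra.
have hk k : (k <= n)%N -> `|g x - g (k%:R / n%:R)| <= dev k.
  move=> /kn hk; apply: (le_trans (hM _ _ hx hk)); rewrite lerD2l.
  rewrite le_eqVlt; apply/orP; left; apply/eqP; field; rewrite gt_eqF //.
rewrite ler_distlC; apply/andP; split.
  have : (bernstein n (fun k => g x + (-1) * dev k)).[x] <=
      (bernstein n (fun k => g (k%:R / n%:R))).[x].
    by apply: le_bernstein => // k /hk; rewrite ler_distl; lra.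
  by rewrite bernsteinD bernstein_cst bernsteinZ; lra.
have : (bernstein n (fun k => g (k%:R / n%:R))).[x] <=
    (bernstein n (fun k => g x + dev k)).[x].
  by apply: le_bernstein => // k /hk; rewrite ler_distl; lra.
by rewrite bernsteinD bernstein_cst; lra.
Qed.

Theorem weierstrass (f : R -> R) (A e : R) : continuous f -> 0 < A -> 0 < e ->
  exists p : {poly R}, forall x, - A <= x <= A -> `|f x - p.[x]| <= e.
Proof.
move=> cf A0 e0; pose g y := f (2 * A * y - A).
have cg : continuous g.
  move=> y; apply: (continuous_comp (f := fun y => 2 * A * y - A)); last exact: cf.
  move: y; apply: continuous_sub; last exact: continuous_const.
  by apply: continuous_mul; [exact: continuous_const | move=> x; exact: cvg_id].
have [p hp] := weierstrass01 cg e0.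
exists (p \Po ((2 * A)^-1 *: ('X + A%:P))) => x /andP[xl xr].
rewrite horner_comp !hornerE.
have A20 : 0 < 2 * A by rewrite mulr_gt0.
have := hp ((2 * A)^-1 * (x + A)); rewrite /g mulVKf ?gt_eqF // addrK; apply.
rewrite mulr_ge0 ?invr_ge0 ?(ltW A20) //=; last by lra.
by rewrite mulrC ler_pdivrMr // mul1r; lra.
Qed.

End weierstrass.

(** * Convergence of moments implies weak convergence *)

Section moment_method.
Variables (R : realType) (w : R).
Hypothesis w_gt0 : 0 < w.
Local Notation mu := (@lebesgue_measure R).
Local Notation a := (semicircle_radius w).
Local Notation m := (semicircle_moment w).

Definition semicircle_mean (f : R -> R) : R :=
  \int[mu]_(x in `[- a, a]) (f x * semicircle_pdf w x).
Local Notation L := semicircle_mean.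

Let int_pdf (f : R -> R) : continuous f ->
  mu.-integrable `[- a, a] (EFin \o (fun x => f x * semicircle_pdf w x)).
Proof.
move=> cf; apply: continuous_integrable_segment; apply: continuous_mul => //.
exact: continuous_semicircle_pdf.
Qed.

Let cX k : continuous (fun x : R => x ^+ k). Proof. exact: continuous_X. Qed.

Let LX k : L (fun x => x ^+ k) = m k.
Proof.
have := integral_semicircleX w k.
by rewrite integral_semicircle // => -[].
Qed.

Let chorner (p : {poly R}) : continuous (fun x : R => p.[x]).
Proof. exact: continuous_horner. Qed.

Lemma semicircle_mean_horner (p : {poly R}) :
  L (fun x => p.[x]) = \sum_(i < size p) p`_i * m i.
Proof.
rewrite /L; under eq_Rintegral do rewrite horner_coef.
elim: (size p) => [|n IH].
  rewrite big_ord0; under eq_Rintegral do rewrite big_ord0 mul0r.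
  by rewrite Rintegral_cst // mul0r.
have cs : continuous (fun x : R => \sum_(i < n) p`_i * x ^+ i).
  elim: n {IH} => [|n IH].
    by under eq_fun do rewrite big_ord0; exact: continuous_const.
  under eq_fun do rewrite big_ord_recr /=.
  apply: continuous_add => //; apply: continuous_mul; last exact: cX.
  exact: continuous_const.
rewrite big_ord_recr /= -IH -LX /L -RintegralZl //; last exact: int_pdf.
rewrite -RintegralD //.
- by apply: eq_Rintegral => x _; rewrite big_ord_recr /=; ring.
- exact: int_pdf.
- apply: continuous_integrable_segment; apply: continuous_mul.
    exact: continuous_const.
  by apply: continuous_mul; [exact: cX | exact: continuous_semicircle_pdf].
Qed.

Lemma le_semicircle_mean (f g : R -> R) (e : R) : continuous f -> continuous g ->
  (forall x, - a <= x <= a -> `|f x - g x| <= e) -> `|L f - L g| <= e.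
Proof.
move=> cf cg fg; rewrite /L -RintegralB //; [|exact: int_pdf|exact: int_pdf].
have cfg : continuous (fun x : R => f x * semicircle_pdf w x - g x * semicircle_pdf w x).
  by apply: continuous_sub; apply: continuous_mul => //; exact: continuous_semicircle_pdf.
apply: (le_trans (le_normr_Rintegral _ _)) => //.
  exact: continuous_integrable_segment.
have <- : L (fun=> e) = e.
  transitivity (e * L (fun x => x ^+ 0)).
    rewrite /L -RintegralZl //; last exact: int_pdf.
    by apply: eq_Rintegral => x _; rewrite expr0 mul1r.
  by rewrite LX semicircle_moment0 // mulr1.
apply: le_Rintegral => //.
- apply: continuous_integrable_segment => x.
  by apply: (cvg_comp _ Num.norm (cfg x)); exact: norm_continuous.
- by apply: int_pdf; exact: continuous_const.
- move=> x; rewrite /= in_itv /= => hx.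
  rewrite -mulrBl normrM (ger0_norm (semicircle_pdf_ge0 w x)).
  by rewrite ler_wpM2r ?semicircle_pdf_ge0 ?fg.
Qed.

Variable lam : nat -> seq R.
Hypothesis size_lam : forall n, size (lam n) = n.

Definition empirical_mean n (f : R -> R) : R := n%:R^-1 * \sum_(x <- lam n) f x.
Local Notation avg := empirical_mean.

Let le_avg n f g : (forall x, f x <= g x) -> avg n f <= avg n g.
Proof. by move=> fg; rewrite ler_wpM2l ?invr_ge0 // ler_sum. Qed.

Let avgD n f g : avg n (fun x => f x + g x) = avg n f + avg n g.
Proof. by rewrite /avg big_split mulrDr. Qed.

Let avgZ n c f : avg n (fun x => c * f x) = c * avg n f.
Proof. by rewrite /avg -mulr_sumr mulrCA. Qed.

Let avg_cst n c : (0 < n)%N -> avg n (fun=> c) = c.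
Proof.
move=> n0; rewrite /avg big_const_seq count_predT size_lam iter_addr_0.
by rewrite -[c *+ n]mulr_natl mulKf // pnatr_eq0 -lt0n.
Qed.

Let avg_horner n (p : {poly R}) :
  avg n (fun x => p.[x]) = \sum_(i < size p) p`_i * avg n (fun x => x ^+ i).
Proof.
rewrite /avg; under [in LHS]eq_bigr do rewrite horner_coef.
rewrite exchange_big mulr_sumr; apply: eq_bigr => i _ /=.
by rewrite -mulr_sumr mulrCA.
Qed.

Hypothesis cvg_moments :
  forall k, avg n (fun x => x ^+ k) @[n --> \oo] --> m k.

Let cvg_avg_horner (p : {poly R}) :
  avg n (fun x => p.[x]) @[n --> \oo] --> L (fun x => p.[x]).
Proof.
rewrite semicircle_mean_horner; under eq_fun do rewrite avg_horner.
suff h k : \sum_(i < k) p`_i * avg n (fun x => x ^+ i) @[n --> \oo] -->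
    \sum_(i < k) p`_i * m i by exact: h.
elim: k => [|k IH].
  by rewrite big_ord0; under eq_fun do rewrite big_ord0; exact: cvg_cst.
rewrite big_ord_recr /=; under eq_fun do rewrite big_ord_recr /=.
by apply: cvgD => //; apply: cvgM; [exact: cvg_cst | exact: cvg_moments].
Qed.

(** Outside a segment strictly larger than the support, the error of a polynomial
    approximation is dominated by a large even power of [x], whose mean is
    controlled by the moments of the limit. *)
Theorem cvg_empirical_mean (f : R -> R) (C : R) : continuous f ->
  (forall x, `|f x| <= C) -> avg n f @[n --> \oo] --> L f.
Proof.
move=> cf fC; apply/cvgrPdist_le => e e0.
have e4 : 0 < e / 4 by rewrite divr_gt0.
have a0 := semicircle_radius_gt0 w_gt0.
pose A := a + 1; have A0 : 0 < A by rewrite addr_gt0.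
have A1 : 1 <= A by rewrite /A lerDr ltW.
have C0 : 0 <= C by exact: le_trans (normr_ge0 _) (fC 0).
have [p hp] := weierstrass cf A0 e4.
pose d := size p; pose B := C + \sum_(i < d) `|p`_i|.
have B0 : 0 <= B by rewrite addr_ge0 // sumr_ge0.
have tail r x : `|f x - p.[x]| <= e / 4 + B / A ^+ r.*2 * x ^+ (d + r).*2.
  have xx k : 0 <= x ^+ k.*2 by rewrite -mul2n exprM exprn_ge0 // sqr_ge0.
  have [xA|xA] := leP `|x| A.
    apply: le_trans (hp x _) _; first by rewrite -ler_norml.
    by rewrite lerDl mulr_ge0 // divr_ge0 // exprn_ge0 // ltW.
  have x1 : 1 <= `|x| by rewrite ltW // (le_lt_trans A1).
  rewrite -[leLHS]add0r lerD ?(ltW e4) //.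
  have xe k : x ^+ k.*2 = `|x| ^+ k.*2.
    by rewrite -normrX ger0_norm.
  have h1 : `|f x - p.[x]| <= B * `|x| ^+ d.*2.
    apply: (le_trans (ler_normB _ _)); rewrite mulrDl lerD //.
      by apply: (le_trans (fC x)); rewrite ler_peMr // exprn_ege1.
    rewrite horner_coef mulr_suml; apply: (le_trans (ler_norm_sum _ _ _)).
    apply: ler_sum => i _; rewrite normrM normrX ler_wpM2l // ler_weXn2l //.
    by have := ltn_ord i; rewrite /d; lia.
  apply: (le_trans h1); rewrite doubleD exprD !xe -mulrA ler_wpM2l //.
  rewrite mulrCA ler_peMr ?exprn_ge0 // mulrC ler_pdivlMr ?exprn_gt0 // mul1r.
  by apply: lerXn2r; rewrite ?nnegrE ?(ltW A0) ?(ltW xA).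
have q1 : `|(a / A) ^+ 2| < 1.
  rewrite normrX expr_lt1 // ger0_norm ?divr_ge0 ?(ltW a0) ?(ltW A0) //.
  by rewrite ltr_pdivrMr // mul1r /A ltrDl.
have [r hr] : exists r, B * a ^+ d.*2 * ((a / A) ^+ 2) ^+ r < e / 4.
  have : B * a ^+ d.*2 * ((a / A) ^+ 2) ^+ n @[n --> \oo] --> (0 : R).
    rewrite -(mulr0 (B * a ^+ d.*2)); apply: cvgM; first exact: cvg_cst.
    exact: cvg_expr.
  move=> /cvgrPdist_lt /(_ _ e4) [r _ /(_ r (leqnn r))] /=.
  by rewrite sub0r normrN => h; exists r; exact: le_lt_trans (ler_norm _) h.
pose b := B / A ^+ r.*2.
have b0 : 0 <= b by rewrite divr_ge0 // exprn_ge0 // ltW.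
have hb : b * m (d + r).*2 < e / 4.
  apply: le_lt_trans hr; rewrite -exprM mul2n expr_div_n /b.
  have /andP[_ ma] := semicircle_moment_even_bound w_gt0 (d + r).
  apply: (le_trans (ler_wpM2l b0 ma)); rewrite doubleD exprD /b.
  by rewrite le_eqVlt; apply/orP; left; apply/eqP; ring.
have cvgb : b * avg n (fun x => x ^+ (d + r).*2) @[n --> \oo] --> b * m (d + r).*2.
  by apply: cvgM; [exact: cvg_cst | exact: cvg_moments].
have hLfp : `|L f - L (fun x => p.[x])| <= e / 4.
  apply: le_semicircle_mean => // x /andP[x1 x2]; apply: hp.
  by rewrite /A; lra.
near=> n.
have n0 : (0 < n)%N by near: n; exact: nbhs_infty_gt.
have h2 : `|L (fun x => p.[x]) - avg n (fun x => p.[x])| <= e / 4.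
  by near: n; move/cvgrPdist_le: (@cvg_avg_horner p); apply.
have h3 : b * avg n (fun x => x ^+ (d + r).*2) <= e / 4.
  by near: n; apply: cvgr_le cvgb _ hb.
have h4 : `|avg n f - avg n (fun x => p.[x])| <= e / 4 + e / 4.
  have dev : avg n (fun x => e / 4 + b * x ^+ (d + r).*2) <= e / 4 + e / 4.
    by rewrite avgD avg_cst // avgZ lerD2l.
  have hl x : p.[x] <= f x + (e / 4 + b * x ^+ (d + r).*2).
    by have := tail r x; rewrite -/b ler_distl; lra.
  have hu x : f x <= p.[x] + (e / 4 + b * x ^+ (d + r).*2).
    by have := tail r x; rewrite -/b ler_distl; lra.
  have := le_avg n hl; have := le_avg n hu; rewrite !avgD ler_distl.
  by move: dev; rewrite avgD; lra.
have := ler_distD (L (fun x => p.[x])) (L f) (avg n f).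
have := ler_distD (avg n (fun x => p.[x])) (L (fun x => p.[x])) (avg n f).
rewrite [`|avg n (fun x => p.[x]) - avg n f|]distrC; lra.
Unshelve. all: by end_near. Qed.

End moment_method.

(** * The ring of random variables with moments of all orders *)

Section finite_moments.
Context {d : measure_display} {T : measurableType d} {R : realType}.
Variable P : probability T R.

Definition finite_moments (X : T -> R) : Prop :=
  measurable_fun [set: T] X /\
  forall k, P.-integrable [set: T] (fun t => (`|X t| ^+ k)%:E).

Lemma finite_moments_integrable (X : T -> R) : finite_moments X ->
  P.-integrable [set: T] (EFin \o X).
Proof.
move=> [mX /(_ 1%N) iX]; apply: le_integrable iX => //.
  exact/measurable_EFinP.
by move=> t _ /=; rewrite expr1 lee_fin normr_id.
Qed.

Lemma finite_moments_cst (c : R) : finite_moments (fun=> c).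
Proof.
split=> [|k]; first exact: measurable_cst.
exact: finite_measure_integrable_cst.
Qed.

Lemma finite_momentsN (X : T -> R) : finite_moments X -> finite_moments (fun t => - X t).
Proof.
move=> [mX iX]; split=> [|k]; first exact: measurableT_comp.
by under eq_fun do rewrite normrN.
Qed.

Lemma finite_momentsD (X Y : T -> R) : finite_moments X -> finite_moments Y ->
  finite_moments (fun t => X t + Y t).
Proof.
move=> [mX iX] [mY iY]; have mXY : measurable_fun [set: T] (fun t => X t + Y t).
  exact: measurable_funD.
split=> // k.
apply: (@le_integrable _ _ _ P _ measurableT _
  (fun t => (2 ^+ k)%:E * ((`|X t| ^+ k)%:E + (`|Y t| ^+ k)%:E))%E).
- by apply/measurable_EFinP; apply: measurable_funX; exact: measurableT_comp.
- move=> t _; rewrite -EFinD -EFinM /= lee_fin.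
  have r0 : 0 <= 2 ^+ k * (`|X t| ^+ k + `|Y t| ^+ k).
    by rewrite mulr_ge0 ?addr_ge0 ?exprn_ge0.
  rewrite normrX normr_id (ger0_norm r0) {r0}.
  wlog xy : X Y mX iX mY iY mXY / `|X t| <= `|Y t|.
    move=> H; have [|/ltW] := leP `|X t| `|Y t|; first exact: H.
    move=> yx; rewrite (addrC (X t)) (addrC (`|X t| ^+ k)); apply: H => //.
    by under eq_fun do rewrite addrC.
  apply: (@le_trans _ _ ((2 * `|Y t|) ^+ k)).
    rewrite lerXn2r ?nnegrE ?mulr_ge0 //.
    by apply: (le_trans (ler_normD _ _)); rewrite mulr_natl mulr2n lerD2r.
  by rewrite exprMn ler_wpM2l ?exprn_ge0 // lerDr exprn_ge0.
- by apply: integrableZl => //; apply: integrableD => //.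
Qed.

Lemma finite_momentsM (X Y : T -> R) : finite_moments X -> finite_moments Y ->
  finite_moments (fun t => X t * Y t).
Proof.
move=> [mX iX] [mY iY]; split=> [|k]; first exact: measurable_funM.
apply: (@le_integrable _ _ _ P _ measurableT _
  (fun t => (`|X t| ^+ (k + k))%:E + (`|Y t| ^+ (k + k))%:E)%E).
- apply/measurable_EFinP; apply: measurable_funX; apply: measurableT_comp => //.
  exact: measurable_funM.
- move=> t _; rewrite -EFinD /= lee_fin.
  have r0 : 0 <= `|X t| ^+ (k + k) + `|Y t| ^+ (k + k).
    by rewrite addr_ge0 ?exprn_ge0.
  rewrite normrX normr_id (ger0_norm r0) normrM exprMn !exprD.
  have x0 : 0 <= `|X t| ^+ k by rewrite exprn_ge0.
  have y0 : 0 <= `|Y t| ^+ k by rewrite exprn_ge0.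
  by move: (`|X t| ^+ k) (`|Y t| ^+ k) x0 y0 => x y x0 y0; nra.
- by apply: integrableD => //.
Qed.

(** Products of such variables are again integrable: this is why all moments are
    required at once. *)
Definition complex_finite_moments : {pred T -> R[i]} :=
  [pred Z : T -> R[i] | `[< finite_moments (fun t => complex.Re (Z t)) /\
                            finite_moments (fun t => complex.Im (Z t)) >]].

Lemma complex_finite_momentsP (Z : T -> R[i]) :
  reflect (finite_moments (fun t => complex.Re (Z t)) /\
           finite_moments (fun t => complex.Im (Z t)))
    (Z \in complex_finite_moments).
Proof. by rewrite inE; exact: asboolP. Qed.

Lemma complex_finite_moments_subring : subring_closed complex_finite_moments.
Proof.
split.
- by apply/complex_finite_momentsP; split; exact: finite_moments_cst.
- move=> X Y /complex_finite_momentsP[X1 X2] /complex_finite_momentsP[Y1 Y2].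
  apply/complex_finite_momentsP; split.
    apply: (eq_rect _ finite_moments (finite_momentsD X1 (finite_momentsN Y1))).
    by apply/funext => t; rewrite -raddfB.
  apply: (eq_rect _ finite_moments (finite_momentsD X2 (finite_momentsN Y2))).
  by apply/funext => t; rewrite -raddfB.
- move=> X Y /complex_finite_momentsP[X1 X2] /complex_finite_momentsP[Y1 Y2].
  apply/complex_finite_momentsP; split.
    apply: (eq_rect _ finite_moments (finite_momentsD (finite_momentsM X1 Y1)
      (finite_momentsN (finite_momentsM X2 Y2)))).
    by apply/funext => t; rewrite mulrfctE /=; case: (X t); case: (Y t).
  apply: (eq_rect _ finite_moments (finite_momentsD (finite_momentsM X1 Y2)
      (finite_momentsM X2 Y1))).
  by apply/funext => t; rewrite mulrfctE /=; case: (X t); case: (Y t).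
Qed.

HB.instance Definition _ :=
  GRing.isSubringClosed.Build (T -> R[i]) complex_finite_moments
    complex_finite_moments_subring.

Record momentRV := MomentRV {
  rv_fun :> T -> R[i];
  rv_finite_moments : rv_fun \in complex_finite_moments }.

HB.instance Definition _ := [isSub for rv_fun].
HB.instance Definition _ := [Choice of momentRV by <:].
HB.instance Definition _ :=
  GRing.SubChoice_isSubComPzRing.Build _ _ momentRV (subringClosedP _).

Lemma rvD (X Y : momentRV) t : (X + Y) t = X t + Y t. Proof. by []. Qed.
Lemma rvM (X Y : momentRV) t : (X * Y) t = X t * Y t. Proof. by []. Qed.

Lemma momentRV_eq (X Y : momentRV) : (forall t, X t = Y t) -> X = Y.
Proof. by move=> h; apply: val_inj; apply/funext. Qed.

Lemma rv_Re (X : momentRV) : finite_moments (fun t => complex.Re (X t)).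
Proof. by case: (complex_finite_momentsP _ (rv_finite_moments X)). Qed.

Lemma rv_Im (X : momentRV) : finite_moments (fun t => complex.Im (X t)).
Proof. by case: (complex_finite_momentsP _ (rv_finite_moments X)). Qed.

Definition rv_eval (t : T) (X : momentRV) : R[i] := X t.

Lemma rv_eval_zmod_morphism t : zmod_morphism (rv_eval t).
Proof. by []. Qed.

Lemma rv_eval_monoid_morphism t : monoid_morphism (rv_eval t).
Proof. by []. Qed.

HB.instance Definition _ t :=
  GRing.isZmodMorphism.Build _ _ (rv_eval t) (rv_eval_zmod_morphism t).
HB.instance Definition _ t :=
  GRing.isMonoidMorphism.Build _ _ (rv_eval t) (rv_eval_monoid_morphism t).

Lemma rv_cst_subproof (c : R[i]) : (fun _ : T => c) \in complex_finite_moments.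
Proof. by apply/complex_finite_momentsP; split; exact: finite_moments_cst. Qed.

Definition rv_cst (c : R[i]) : momentRV := MomentRV (rv_cst_subproof c).

Lemma rv_cst_zmod_morphism : zmod_morphism rv_cst.
Proof. by move=> c c'; apply: momentRV_eq. Qed.

Lemma rv_cst_monoid_morphism : monoid_morphism rv_cst.
Proof. by split=> [|c c']; apply: momentRV_eq. Qed.

HB.instance Definition _ :=
  GRing.isZmodMorphism.Build _ _ rv_cst rv_cst_zmod_morphism.
HB.instance Definition _ :=
  GRing.isMonoidMorphism.Build _ _ rv_cst rv_cst_monoid_morphism.

Definition expect (X : momentRV) : R[i] := cexpectation P X.

Lemma expect_zmod_morphism : zmod_morphism expect.
Proof.
move=> X Y; rewrite /expect /cexpectation.
have iX1 := finite_moments_integrable (rv_Re X).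
have iX2 := finite_moments_integrable (rv_Im X).
have iY1 := finite_moments_integrable (rv_Re Y).
have iY2 := finite_moments_integrable (rv_Im Y).
apply/eqP; rewrite eq_complex /= -!RintegralB //.
by apply/andP; split; apply/eqP; apply: eq_Rintegral => t _;
  rewrite /= -raddfB.
Qed.

HB.instance Definition _ :=
  GRing.isZmodMorphism.Build _ _ expect expect_zmod_morphism.

Lemma expect_cst_mul (c : R[i]) X : expect (rv_cst c * X) = c * expect X.
Proof.
rewrite /expect /cexpectation; case: c => a b.
have iX1 := finite_moments_integrable (rv_Re X).
have iX2 := finite_moments_integrable (rv_Im X).
have iZ r (f : T -> R) : P.-integrable [set: T] (EFin \o f) ->
    P.-integrable [set: T] (EFin \o (fun t => r * f t)).
  by move=> fi; exact: (integrableZl measurableT r fi).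
apply/eqP; rewrite eq_complex /= -!RintegralZl //.
rewrite -RintegralB ?iZ // -RintegralD ?iZ //.
by apply/andP; split; apply/eqP; apply: eq_Rintegral => t _;
  rewrite mulrfctE /=; case: (X t).
Qed.

Lemma expect1 : expect 1 = 1.
Proof.
have h (c : R) : \int[P]_t c = c.
  rewrite Rintegral_cst // -[RHS]mulr1; congr (_ * _).
  exact: (congr1 fine (probability_setT P)).
by apply/eqP; rewrite eq_complex /= (h 1) (h 0) !eqxx.
Qed.

End finite_moments.

(** * Independence and products of expectations *)

Lemma cvg_Rintegral_dominated d (T : measurableType d) (R : realType)
    (mu : {measure set T -> \bar R}) (f_ : nat -> T -> R) (f g : T -> R) :
  (forall n, measurable_fun [set: T] (f_ n)) -> measurable_fun [set: T] f ->
  (forall t, f_ n t @[n --> \oo] --> f t) ->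
  mu.-integrable [set: T] (EFin \o g) -> (forall n t, `|f_ n t| <= g t) ->
  \int[mu]_t f_ n t @[n --> \oo] --> \int[mu]_t f t.
Proof.
move=> mf_ mf f_f ig f_g.
have [||||| intf _ H] := @dominated_convergence _ _ _ mu _ measurableT
    (fun n => EFin \o f_ n) (EFin \o f) (EFin \o g).
- by move=> n; exact/measurable_EFinP.
- exact/measurable_EFinP.
- by apply: aeW => t _; apply: cvg_EFin; [exact: nearW | exact: f_f].
- exact: ig.
- by apply: aeW => t n _ /=; rewrite lee_fin.
apply: fine_cvg; rewrite /Rintegral fineK; first exact: H.
exact: integrable_fin_num.
Qed.

Section decoupling.
Context {d d' : measure_display} {T : measurableType d} {S : measurableType d'}.
Context {R : realType}.
Variable P : probability T R.
Local Notation fm := (finite_moments P).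

Lemma RintegralD_fm (f g : T -> R) : fm f -> fm g ->
  \int[P]_t (f t + g t) = \int[P]_t f t + \int[P]_t g t.
Proof. by move=> mf mg; rewrite RintegralD //; exact: finite_moments_integrable. Qed.

Lemma RintegralZ_fm c (f : T -> R) : fm f ->
  \int[P]_t (c * f t) = c * \int[P]_t f t.
Proof. by move=> mf; rewrite RintegralZl //; exact: finite_moments_integrable. Qed.

Lemma finite_moments_indic (X : T -> S) (B : set S) :
  measurable_fun [set: T] X -> measurable B -> fm (fun t => \1_B (X t)).
Proof.
move=> mX mB; have m1 : measurable_fun [set: T] (fun t => \1_B (X t) : R).
  by apply: measurableT_comp mX; exact: measurable_indic.
split=> // k; apply: le_integrable (finite_measure_integrable_cst P 1 measurableT) => //.
  by apply/measurable_EFinP; apply: measurable_funX; exact: measurableT_comp.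
move=> t _ /=; rewrite lee_fin normr1 normrX normr_id exprn_ile1 //.
by rewrite indicE; case: (_ \in _); rewrite ?normr0 ?normr1.
Qed.

Variables (X : T -> S) (G : T -> R).
(* Independence enters as the factorization against indicators, which is inherited
   by simple functions and by dominated limits. *)
Hypotheses (mX : measurable_fun [set: T] X) (mG : fm G).

Hypothesis indep : forall B, measurable B ->
  \int[P]_t (\1_B (X t) * G t) = \int[P]_t \1_B (X t) * \int[P]_t G t.

Let decouple_simple (s : seq R) (B : R -> set S) : (forall y, measurable (B y)) ->
  fm (fun t => \sum_(y <- s) y * \1_(B y) (X t)) /\
  \int[P]_t ((\sum_(y <- s) y * \1_(B y) (X t)) * G t) =
  \int[P]_t (\sum_(y <- s) y * \1_(B y) (X t)) * \int[P]_t G t.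
Proof.
move=> mB; elim: s => [|y s].
  have -> : (fun t => \sum_(y <- [::]) y * \1_(B y) (X t)) = (fun=> 0) :> (T -> R).
    by apply/funext => t; rewrite big_nil.
  split; first exact: finite_moments_cst.
  under eq_Rintegral do rewrite big_nil mul0r.
  by rewrite !Rintegral_cst // !mul0r.
set F := (fun t => \sum_(y <- s) y * \1_(B y) (X t)) => -[IH1 IH2].
have -> : (fun t => \sum_(z <- y :: s) z * \1_(B z) (X t)) =
    (fun t => y * \1_(B y) (X t) + F t).
  by apply/funext => t; rewrite big_cons.
have f1 : fm (fun t => \1_(B y) (X t)) by exact: finite_moments_indic.
have fy : fm (fun t => y * \1_(B y) (X t)).
  by apply: finite_momentsM => //; exact: finite_moments_cst.
split; first exact: finite_momentsD.
under eq_Rintegral do rewrite big_cons mulrDl -mulrA.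
have f1G : fm (fun t => \1_(B y) (X t) * G t) by exact: finite_momentsM.
rewrite !RintegralD_fm //; last 2 first.
- by apply: finite_momentsM => //; exact: finite_moments_cst.
- exact: finite_momentsM.
by rewrite !RintegralZ_fm // IH2 indep // mulrDl mulrA.
Qed.

Import HBNNSimple.

Let decouple_ge0 (h : S -> R) : measurable_fun [set: S] h -> (forall x, 0 <= h x) ->
  fm (fun t => h (X t)) ->
  \int[P]_t (h (X t) * G t) = \int[P]_t h (X t) * \int[P]_t G t.
Proof.
move=> mh h0 fh.
have mhE : measurable_fun [set: S] (EFin \o h) by exact/measurable_EFinP.
pose h_ := nnsfun_approx measurableT mhE.
have cvgh x : h_ n x @[n --> \oo] --> h x.
  have := @cvg_nnsfun_approx _ _ _ _ measurableT _ mhE (fun y _ => h0 y) x I.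
  by move=> /fine_cvg.
have leh n x : h_ n x <= h x.
  rewrite -lee_fin /h_ nnsfun_approxE; apply: le_approx => //.
  by move=> y _; rewrite lee_fin.
have fG : fm (fun t => h (X t) * G t) by exact: finite_momentsM.
have simple n : fm (fun t => h_ n (X t)) /\
    \int[P]_t (h_ n (X t) * G t) = \int[P]_t h_ n (X t) * \int[P]_t G t.
  pose s : seq R := finmap.enum_fset (fset_set (range (h_ n))).
  have hE x : h_ n x = \sum_(y <- s) y * \1_(h_ n @^-1` [set y]) x.
    by rewrite fimfunE fsbig_finite.
  have [|f1 f2] := @decouple_simple s (fun y => h_ n @^-1` [set y]).
    by move=> y; exact: measurable_funPTI.
  split; first by under eq_fun do rewrite hE.
  under eq_Rintegral do rewrite hE.
  by under [in RHS]eq_Rintegral do rewrite hE.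
have cvg1 : \int[P]_t (h_ n (X t) * G t) @[n --> \oo] --> \int[P]_t (h (X t) * G t).
  apply: (@cvg_Rintegral_dominated _ _ _ P _ _ (fun t => `|h (X t) * G t|)).
  - by move=> n; apply: measurable_funM; [case: (simple n) => -[] | case: mG].
  - by case: fG.
  - by move=> t; apply: cvgM; [exact: cvgh | exact: cvg_cst].
  - by case: fG => _ /(_ 1%N); under eq_fun do rewrite expr1.
  - by move=> n t; rewrite !normrM ler_wpM2r // !ger0_norm.
have cvg2 : \int[P]_t h_ n (X t) @[n --> \oo] --> \int[P]_t h (X t).
  apply: (@cvg_Rintegral_dominated _ _ _ P _ _ (fun t => h (X t))).
  - by move=> n; case: (simple n) => -[].
  - by case: fh.
  - by move=> t; exact: cvgh.
  - exact: finite_moments_integrable.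
  - by move=> n t; rewrite ger0_norm.
have cvg3 : \int[P]_t (h_ n (X t) * G t) @[n --> \oo] -->
    \int[P]_t h (X t) * \int[P]_t G t.
  rewrite (_ : (fun n => _) = (fun n => \int[P]_t h_ n (X t) * \int[P]_t G t)).
    by apply: cvgM; [exact: cvg2 | exact: cvg_cst].
  by apply/funext => n; rewrite (simple n).2.
exact: (cvg_unique _ cvg1 cvg3).
Qed.

Lemma decouple (h : S -> R) : measurable_fun [set: S] h ->
  fm (fun t => h (X t)) ->
  \int[P]_t (h (X t) * G t) = \int[P]_t h (X t) * \int[P]_t G t.
Proof.
move=> mh fh.
have mhX : measurable_fun [set: T] (fun t => h (X t)) by case: fh.
have le_fm (g : S -> R) : measurable_fun [set: S] g -> (forall x, `|g x| <= `|h x|) ->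
    fm (fun t => g (X t)).
  move=> mg gh; have mgX : measurable_fun [set: T] (fun t => g (X t)).
    exact: measurableT_comp.
  split=> // k; case: fh => _ /(_ k); apply: le_integrable => //.
    by apply/measurable_EFinP; apply: measurable_funX; exact: measurableT_comp.
  by move=> t _ /=; rewrite lee_fin !normrX !normr_id lerXn2r ?nnegrE.
pose hp x := Num.max (h x) 0; pose hn x := Num.max (- h x) 0.
have mp : measurable_fun [set: S] hp.
  by apply: measurable_maxr => //; exact: measurable_cst.
have mn : measurable_fun [set: S] hn.
  by apply: measurable_maxr; [exact: measurableT_comp | exact: measurable_cst].
have fp : fm (fun t => hp (X t)).
  apply: le_fm => // x; rewrite /hp; case: (leP (h x) 0) => // _.
  by rewrite normr0.
have fn : fm (fun t => hn (X t)).
  apply: le_fm => // x; rewrite /hn; case: (leP (- h x) 0) => // _.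
    by rewrite normr0.
  by rewrite normrN.
have hE x : h x = hp x + (-1) * hn x.
  rewrite /hp /hn; case: (leP (h x) 0) => h0.
    by rewrite max_l ?oppr_ge0 //; ring.
  by rewrite max_r ?oppr_le0 1?ltW //; ring.
have p0 x : 0 <= hp x by rewrite le_max lexx orbT.
have n0 x : 0 <= hn x by rewrite le_max lexx orbT.
under eq_Rintegral do rewrite hE mulrDl -mulrA.
under [in RHS]eq_Rintegral do rewrite hE.
have fpG : fm (fun t => hp (X t) * G t) by exact: finite_momentsM.
have fnG : fm (fun t => hn (X t) * G t) by exact: finite_momentsM.
have fc : fm (fun=> -1) by exact: finite_moments_cst.
rewrite !RintegralD_fm ?RintegralZ_fm //; last 2 first.
- exact: (finite_momentsM fc fnG).
- exact: (finite_momentsM fc fn).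
by rewrite !decouple_ge0 // mulrDl mulrA.
Qed.

End decoupling.

Section random_matrix_entries.
Context {d : measure_display} {T : measurableType d} {R : realType}.
Variable P : probability T R.
Local Notation rv := (momentRV P).
Local Notation E := (@expect _ _ _ P).
Local Notation fm := (finite_moments P).

Lemma real_rv_subproof (f : T -> R) : fm f ->
  (fun t => (f t)%:C) \in complex_finite_moments P.
Proof.
by move=> mf; apply/complex_finite_momentsP; split=> //=; exact: finite_moments_cst.
Qed.

Definition real_rv (f : T -> R) (mf : fm f) : rv := MomentRV (real_rv_subproof mf).

Lemma expect_real_rv (f : T -> R) (mf : fm f) :
  E (real_rv mf) = (\int[P]_t f t)%:C.
Proof.
by rewrite /expect /cexpectation /=; congr (_ +i* _); rewrite Rintegral_cst // mul0r.
Qed.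

Lemma expect_decouple d' (S : measurableType d') (X : T -> S) (G H : rv)
    (hr hi : S -> R) :
  measurable_fun [set: T] X ->
  (forall (B : set S) (b : rv), measurable B -> (forall t, b t = (\1_B (X t))%:C) ->
     E (b * G) = E b * E G) ->
  measurable_fun [set: S] hr -> measurable_fun [set: S] hi ->
  (forall t, H t = hr (X t) +i* hi (X t)) ->
  E (H * G) = E H * E G.
Proof.
move=> mX indep mr mi HE.
have fGr := rv_Re G; have fGi := rv_Im G.
have fr : fm (fun t => hr (X t)).
  by have := rv_Re H; under eq_fun do rewrite HE.
have fi : fm (fun t => hi (X t)).
  by have := rv_Im H; under eq_fun do rewrite HE.
have indep2 B : measurable B ->
    \int[P]_t (\1_B (X t) * complex.Re (G t)) =
      \int[P]_t \1_B (X t) * \int[P]_t complex.Re (G t) /\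
    \int[P]_t (\1_B (X t) * complex.Im (G t)) =
      \int[P]_t \1_B (X t) * \int[P]_t complex.Im (G t).
  move=> mB; have fB := finite_moments_indic P mX mB.
  have := indep B (real_rv fB) mB (fun t => erefl).
  rewrite expect_real_rv /expect /cexpectation => /eqP.
  rewrite eq_complex /= !mul0r subr0 addr0 => /andP[/eqP e1 /eqP e2].
  rewrite -e1 -e2; split; apply: eq_Rintegral => t _; rewrite mulrfctE /=;
    by case: (G t) => x y /=; rewrite !mul0r ?subr0 ?addr0.
have dec := decouple mX.
apply/eqP; rewrite eq_complex /=; apply/andP; split; apply/eqP.
  transitivity (\int[P]_t (hr (X t) * complex.Re (G t) +
                  (-1) * (hi (X t) * complex.Im (G t)))).
    apply: eq_Rintegral => t _; rewrite mulrfctE HE.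
    by case: (G t) => x y /=; rewrite mulN1r.
  have f1 := finite_momentsM fr fGr; have f2 := finite_momentsM fi fGi.
  have f3 := finite_momentsM (finite_moments_cst P (-1)) f2.
  rewrite RintegralD_fm // RintegralZ_fm // !dec //; try by move=> B /indep2 [].
  under [in RHS]eq_Rintegral do rewrite HE.
  rewrite mulN1r; congr (_ - _ * _).
  by apply: eq_Rintegral => t _; rewrite HE.
transitivity (\int[P]_t (hr (X t) * complex.Im (G t) +
                hi (X t) * complex.Re (G t))).
  by apply: eq_Rintegral => t _; rewrite mulrfctE HE; case: (G t) => x y.
have f1 := finite_momentsM fr fGi; have f2 := finite_momentsM fi fGr.
rewrite RintegralD_fm // !dec //; try by move=> B /indep2 [].
congr (_ * _ + _ * _); by apply: eq_Rintegral => t _; rewrite HE.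
Qed.

Variable W : nat -> nat -> T -> R[i].
Hypothesis W_hermitian : forall j k t, W j k t = (W k j t)^*%C.
Hypothesis W_independent : mutually_independent P
  [set jk : nat * nat | (jk.1 <= jk.2)%N] (fun jk => W jk.1 jk.2).
Hypothesis W_measurable : forall j k, measurable_fun [set: T] (reim (W j k)).
Hypothesis W_moments : forall j k, W j k \in complex_finite_moments P.

Definition entry (p : nat * nat) : rv := MomentRV (W_moments p.1 p.2).

(** The entries [W j k] and [W k j] are functions of the same independent
    variable, the one with index [upper (j, k)]. *)
Definition upper (p : nat * nat) : nat * nat :=
  if (p.1 <= p.2)%N then p else transpose p.

Lemma upper_le p : ((upper p).1 <= (upper p).2)%N.
Proof. by rewrite /upper; case: (leqP p.1 p.2) => // h; exact: ltnW. Qed.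

Lemma upper_transpose p : upper (transpose p) = upper p.
Proof.
rewrite /upper /transpose; case: p => j k /=.
by case: (ltngtP j k) => //= ->.
Qed.

Lemma upper_eq p x : upper x = upper p -> x = p \/ x = transpose p.
Proof.
rewrite /upper; case: p x => j k [a b] /=.
case: (leqP a b) => _; case: (leqP j k) => _; rewrite /transpose /= => -[-> ->];
  by [left | right].
Qed.

Let Z (q : nat * nat) : T -> measurableTypeR R * measurableTypeR R :=
  reim (W q.1 q.2).

Definition function_of (q : nat * nat) (H : rv) : Prop :=
  exists h : (measurableTypeR R * measurableTypeR R -> R) *
             (measurableTypeR R * measurableTypeR R -> R),
    [/\ measurable_fun [set: _] h.1, measurable_fun [set: _] h.2 &
        forall t, H t = h.1 (Z q t) +i* h.2 (Z q t)].

Definition indicator_of (q : nat * nat) (b : rv) : Prop :=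
  exists2 B, measurable B & forall t, b t = (\1_B (Z q t))%:C.

Lemma function_of_entry p : function_of (upper p) (entry p).
Proof.
have [pl|pl] := leqP p.1 p.2.
  exists (fst, snd); split=> //=.
  by move=> t; rewrite /upper pl /Z /reim /=; case: (W _ _ t).
exists (fst, fun z => - z.2); split=> //=.
  by apply: measurableT_comp => //; exact: measurable_snd.
move=> t; rewrite /upper leqNgt pl /= /Z /reim W_hermitian /=.
by case: (W _ _ t).
Qed.

Lemma function_of_cst q c : function_of q (rv_cst P c).
Proof.
exists (fun=> complex.Re c, fun=> complex.Im c); split=> //=.
by move=> t; case: c.
Qed.

Lemma function_ofD q G H : function_of q G -> function_of q H ->
  function_of q (G + H).
Proof.
move=> [[g1 g2] /= [mg1 mg2 gE]] [[h1 h2] /= [mh1 mh2 hE]].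
exists (fun z => g1 z + h1 z, fun z => g2 z + h2 z); split=> //=.
- exact: measurable_funD.
- exact: measurable_funD.
- by move=> t; rewrite addrfctE gE hE.
Qed.

Lemma function_ofM q G H : function_of q G -> function_of q H ->
  function_of q (G * H).
Proof.
move=> [[g1 g2] /= [mg1 mg2 gE]] [[h1 h2] /= [mh1 mh2 hE]].
exists (fun z => g1 z * h1 z - g2 z * h2 z, fun z => g1 z * h2 z + g2 z * h1 z).
split=> //=.
- by apply: measurable_funB; exact: measurable_funM.
- by apply: measurable_funD; exact: measurable_funM.
- by move=> t; rewrite mulrfctE gE hE.
Qed.

(** [decoupled S G] is the independence of [G], a function of the variables with
    index in [S], from the other variables, in the form that propagates when a
    factor depending on one more variable is multiplied to [G]. *)
Definition decoupled (S : seq (nat * nat)) (G : rv) : Prop :=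
  forall (u : seq (nat * nat)) (g : nat * nat -> rv), uniq u ->
    (forall i, i \in u -> [/\ (i.1 <= i.2)%N, i \notin S & indicator_of i (g i)]) ->
    E (G * \prod_(i <- u) g i) = E G * \prod_(i <- u) E (g i).

Lemma decoupled1 : decoupled [::] 1.
Proof.
move=> u g uu hu.
have /choice[B hB] : forall i, exists B : set (measurableTypeR R * measurableTypeR R),
    measurable B /\ (i \in u -> forall t, g i t = (\1_B (Z i t))%:C).
  move=> i; have [/hu [_ _ [B mB gB]]|] := boolP (i \in u); first by exists B.
  by move=> _; exists set0.
have mB i : measurable (B i) by case: (hB i).
have mZ i : measurable (Z i @^-1` B i).
  by rewrite -[X in measurable X]setTI; exact: (W_measurable i.1 i.2).
have EgE i : i \in u -> E (g i) = (fine (P (Z i @^-1` B i)))%:C.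
  move=> iu; have fB := finite_moments_indic P (W_measurable i.1 i.2) (mB i).
  have -> : g i = real_rv fB by apply: momentRV_eq => t; case: (hB i) => _ ->.
  rewrite expect_real_rv; congr (_%:C).
  rewrite /Rintegral (_ : (\int[P]_x _)%E = (\int[P]_x (\1_(Z i @^-1` B i) x)%:E)%E).
    by rewrite integral_indic // setIT.
  by apply: eq_integral => t _; rewrite !indicE.
rewrite mul1r expect1 mul1r.
pose A := \bigcap_(i in [set` u]) (Z i @^-1` B i).
have mA : measurable A.
  by apply: fin_bigcap_measurable => [|i _]; [exact: finite_seq | exact: mZ].
have fA : fm (fun t => \1_A t) by exact: (finite_moments_indic P (X := id)).
have -> : \prod_(i <- u) g i = real_rv fA.
  apply: momentRV_eq => t.
  have -> : (\prod_(i <- u) g i) t = \prod_(i <- u) g i t.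
    by rewrite -[LHS]/(rv_eval t (\prod_(i <- u) g i)) rmorph_prod.
  have -> : \prod_(i <- u) g i t = \prod_(i <- u) (\1_(B i) (Z i t))%:C.
    rewrite big_seq [RHS]big_seq; apply: eq_bigr => i iu.
    by case: (hB i) => _ ->.
  rewrite -rmorph_prod /=; congr (_%:C); rewrite indicE.
  have [tA|tA] := boolP (t \in A).
    rewrite big_seq big1 // => i iu; rewrite indicE mem_set //.
    by move: tA; rewrite inE; exact.
  have [i iu ti] : exists2 i, i \in u & ~ B i (Z i t).
    apply: contrapT => h; move/negP: tA; apply; rewrite inE => i iu /=.
    by apply: contrapT => nB; apply: h; exists i.
  rewrite (bigD1_seq i) //= indicE memNset // mul0r //.
rewrite expect_real_rv.
have -> : \int[P]_t \1_A t = fine (P A).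
  by rewrite /Rintegral integral_indic // setIT.
rewrite /A W_independent //; last by move=> i /hu [].
rewrite (_ : (\prod_(i <- u) _)%E = (\prod_(i <- u) fine (P (Z i @^-1` B i)))%:E).
  rewrite /= rmorph_prod /= big_seq [RHS]big_seq; apply: eq_bigr => i iu.
  by rewrite EgE.
elim: (u) => [|i s IH]; first by rewrite !big_nil.
by rewrite !big_cons EFinM IH fineK // fin_num_measure.
Qed.

Lemma decoupled_sub S S' G : {subset S <= S'} -> decoupled S G -> decoupled S' G.
Proof.
move=> sub dG u g uu hu; apply: dG => // i /hu [? iS' ?]; split=> //.
by apply: contra iS'; exact: sub.
Qed.

Lemma expect_function_of_mul S G q H : decoupled S G -> q \notin S ->
  (q.1 <= q.2)%N -> function_of q H -> 
  forall (u : seq (nat * nat)) (g : nat * nat -> rv), uniq u ->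
    (forall i, i \in u ->
       [/\ (i.1 <= i.2)%N, i \notin q :: S & indicator_of i (g i)]) ->
  E (H * (G * \prod_(i <- u) g i)) = E H * E (G * \prod_(i <- u) g i).
Proof.
move=> dG qS ql [[h1 h2] /= [mh1 mh2 hE]] u g uu hu.
apply: (expect_decouple (W_measurable q.1 q.2) _ mh1 mh2 hE) => B b mB bE.
have hu' i : i \in u -> [/\ (i.1 <= i.2)%N, i \notin S & indicator_of i (g i)].
  by move=> /hu [? + ?]; rewrite inE negb_or => /andP[].
rewrite (dG u g uu hu') mulrCA.
pose g' i := if i == q then b else g i.
have qu : q \notin u by apply/negP => /hu []; rewrite mem_head.
have gE (F : rv -> rv) (F' : rv -> R[i]) :
    \prod_(i <- u) F' (g' i) = \prod_(i <- u) F' (g i).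
  rewrite big_seq [RHS]big_seq; apply: eq_bigr => i iu; rewrite /g'.
  by case: eqP => // iq; rewrite -iq iu in qu.
have gE' : \prod_(i <- u) g' i = \prod_(i <- u) g i.
  rewrite big_seq [RHS]big_seq; apply: eq_bigr => i iu; rewrite /g'.
  by case: eqP => // iq; rewrite -iq iu in qu.
have := dG (q :: u) g'; rewrite !big_cons gE' (gE id E) /g' eqxx => ->.
- by rewrite mulrCA.
- by rewrite /= qu.
- move=> i; rewrite inE; case: eqP => [-> _|_ /= /hu' //].
  by split=> //; exists B.
Qed.

Lemma decoupledM S G q H : decoupled S G -> q \notin S ->
  (q.1 <= q.2)%N -> function_of q H -> decoupled (q :: S) (H * G).
Proof.
move=> dG qS ql fH u g uu hu.
have hu' i : i \in u -> [/\ (i.1 <= i.2)%N, i \notin S & indicator_of i (g i)].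
  by move=> /hu [? + ?]; rewrite inE negb_or => /andP[].
rewrite -mulrA (expect_function_of_mul dG qS ql fH uu hu) (dG u g uu hu').
have := expect_function_of_mul dG qS ql fH (u := [::]) (g := g) isT.
by rewrite !big_nil mulr1 => -> //; rewrite mulrA.
Qed.

(** The only consequence of independence used for the matrix: a function of the
    variable with index [q] can be integrated apart. *)
Lemma expectM_function_of S G q H : decoupled S G -> q \notin S ->
  (q.1 <= q.2)%N -> function_of q H -> E (H * G) = E H * E G.
Proof.
move=> dG qS ql fH.
have := expect_function_of_mul dG qS ql fH (u := [::]) (g := fun=> 1) isT.
by rewrite !big_nil mulr1 => ->.
Qed.

Local Notation mono := (monomial entry).
Local Notation dmono := (dmonomial entry).
Let same q L := [seq x <- L | upper x == q].
Let other q L := [seq x <- L | upper x != q].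

Lemma monomial_split q L : mono L = mono (same q L) * mono (other q L).
Proof. by rewrite /monomial !big_filter (bigID (fun x => upper x == q)). Qed.

Lemma dmonomial_split r L : dmono r L =
  dmono r (same (upper r) L) * mono (other (upper r) L).
Proof.
rewrite /same /other; elim: L => [|x L IH] /=; first by rewrite mul0r.
have [e|ne] /= := eqVneq (upper x) (upper r).
  by rewrite IH (monomial_split (upper r) L) /same /other; ring.
have -> : (x == r) = false by apply/eqP => xr; rewrite xr eqxx in ne.
by rewrite mul0r add0r monomial_cons IH mulrCA.
Qed.

Lemma function_of_monomial q L : all (fun x => upper x == q) L ->
  function_of q (mono L).
Proof.
elim: L => [|x L IH] /=.
  by rewrite /monomial big_nil -(rmorph1 (rv_cst P)) => _; exact: function_of_cst.
move=> /andP[/eqP e /IH fL]; rewrite monomial_cons.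
by apply: function_ofM => //; rewrite -e; exact: function_of_entry.
Qed.

Lemma function_of_dmonomial q r L : all (fun x => upper x == q) L ->
  function_of q (dmono r L).
Proof.
elim: L => [|x L IH] /=.
  by rewrite -(rmorph0 (rv_cst P)) => _; exact: function_of_cst.
move=> /andP[/eqP e aL]; apply: function_ofD.
  apply: function_ofM; last exact: function_of_monomial.
  by rewrite -(rmorph_nat (rv_cst P)); exact: function_of_cst.
apply: function_ofM; last exact: IH.
by rewrite -e; exact: function_of_entry.
Qed.

Lemma decoupled_monomial L : decoupled [seq upper x | x <- L] (mono L).
Proof.
have [N] := ubnP (size L); elim: N L => // N IH [|p L] hL.
  by rewrite /monomial big_nil; exact: decoupled1.
pose q := upper p.
rewrite (monomial_split q).
have dO : decoupled [seq upper x | x <- other q (p :: L)] (mono (other q (p :: L))).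
  apply: IH; rewrite /other /= eqxx /= size_filter.
  by apply: leq_ltn_trans (count_size _ _) _.
apply: (@decoupled_sub (q :: [seq upper x | x <- other q (p :: L)])).
  move=> y; rewrite inE => /predU1P[->|]; first by rewrite /q mem_head.
  by move=> /mapP[x]; rewrite mem_filter => /andP[_ xL] ->; exact: map_f.
apply: decoupledM => //.
- by apply/negP => /mapP[x]; rewrite mem_filter => /andP[/eqP + _] e; rewrite -e.
- exact: upper_le.
- by apply: function_of_monomial; exact: filter_all.
Qed.

Variable v : R[i].
Hypothesis offdiagonal_moments : forall p a b, p.1 <> p.2 ->
  E (entry p ^+ a.+1 * entry (transpose p) ^+ b) =
  v * b%:R * E (entry p ^+ a * entry (transpose p) ^+ b.-1).
Hypothesis diagonal_moments : forall j a,
  E (entry (j, j) ^+ a.+1) = v * a%:R * E (entry (j, j) ^+ a.-1).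

(** After the reduction to one index, the monomial is a power of one real variable,
    or a product of powers of a complex variable and its conjugate. *)
Let wick_same p L : all (fun x => upper x == upper p) L ->
  E (entry p * mono L) = v * E (dmono (transpose p) L).
Proof.
move=> aL; have hL x : x \in L -> x = p \/ x = transpose p.
  by move=> /(allP aL) /eqP /upper_eq.
have [pp|pp] := eqVneq p.1 p.2.
  have pT : transpose p = p by case: p pp {aL hL} => j k /= ->.
  have {}hL x : x \in L -> x = p by move=> /hL; rewrite pT => -[].
  have mE L' : {subset L' <= L} -> mono L' = entry p ^+ size L'.
    elim: L' => [|x L' IH] sub; first by rewrite /monomial big_nil.
    rewrite monomial_cons exprS (hL x) ?sub ?mem_head // IH // => y yL.
    by apply: sub; rewrite inE yL orbT.
  have dE L' : {subset L' <= L} -> dmono p L' = entry p ^+ (size L').-1 *+ size L'.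
    elim: L' => [|x L' IH] //= sub.
    have sub' : {subset L' <= L} by move=> y yL; apply: sub; rewrite inE yL orbT.
    rewrite (hL x) ?sub ?mem_head // eqxx mul1r (IH sub') (mE _ sub').
    by case: (size L') => [|n] /=; rewrite ?mulr0 ?addr0 // mulrnAr -exprS -mulrS.
  rewrite pT (mE L) // (dE L) // -exprS raddfMn /=.
  have := diagonal_moments p.1 (size L); rewrite (_ : (p.1, p.1) = p); last first.
    by case: p pp {aL hL pT mE dE} => j k /= ->.
  by move=> ->; rewrite -mulrA mulr_natl.
have pT : transpose p != p.
  apply/eqP => e; move/eqP: pp; apply.
  exact: (esym (congr1 fst e)).
have pT' : p != transpose p by rewrite eq_sym.
have mE L' : {subset L' <= L} -> mono L' = entry p ^+ count_mem p L' *
    entry (transpose p) ^+ count_mem (transpose p) L'.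
  elim: L' => [|x L' IH] sub; first by rewrite /monomial big_nil mulr1.
  rewrite monomial_cons IH; last by move=> y yL; apply: sub; rewrite inE yL orbT.
  rewrite /=; case: (hL x (sub x (mem_head _ _))) => ->; rewrite eqxx.
    by rewrite (negbTE pT') add0n add1n exprS mulrA.
  by rewrite (negbTE pT) add0n add1n exprS mulrCA.
have dE L' : {subset L' <= L} -> dmono (transpose p) L' =
    entry p ^+ count_mem p L' * entry (transpose p) ^+ (count_mem (transpose p) L').-1
      *+ count_mem (transpose p) L'.
  elim: L' => [|x L' IH] //= sub.
  have sub' : {subset L' <= L} by move=> y yL; apply: sub; rewrite inE yL orbT.
  rewrite (IH sub') (mE _ sub').
  case: (hL x (sub x (mem_head _ _))) => ->; rewrite eqxx.
    by rewrite (negbTE pT') add0n add1n exprS mul0r add0r mulrnAr mulrA.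
  rewrite (negbTE pT) add0n add1n /= mul1r; move: (count_mem p L') (count_mem (transpose p) L').
  by move=> a [|b] /=; rewrite ?mulr0 ?addr0 // mulrnAr mulrCA -exprS -mulrS.
rewrite (mE L) // (dE L) // mulrA -exprS raddfMn /= offdiagonal_moments; last by move/eqP: pp.
by rewrite -mulrA mulr_natl.
Qed.

(** Only the entries with the index of [p] are differentiated, and both sides carry
    the same independent factor. *)
Lemma wick p L : E (entry p * mono L) = v * E (dmono (transpose p) L).
Proof.
rewrite (monomial_split (upper p)) dmonomial_split upper_transpose mulrA.
have aL : all (fun x => upper x == upper p) (same (upper p) L) by exact: filter_all.
have nin : upper p \notin [seq upper x | x <- other (upper p) L].
  by apply/negP => /mapP[x]; rewrite mem_filter => /andP[/eqP + _] e; rewrite -e.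
rewrite !(expectM_function_of (@decoupled_monomial (other (upper p) L)) nin (upper_le p)).
- by rewrite wick_same // mulrA.
- exact: function_of_dmonomial.
- apply: function_ofM; [exact: function_of_entry | exact: function_of_monomial].
Qed.

End random_matrix_entries.

(** * Moments of Gaussian random variables *)

(** Transfer of integrals along a random variable whose law has a density. *)
Section law_with_density.
Context {d : measure_display} {T : measurableType d} {R : realType}.
Variable P : probability T R.
Local Notation mu := (@lebesgue_measure R).
Variables (X : T -> measurableTypeR R) (g : R -> R).
Hypotheses (mX : measurable_fun [set: T] X) (g0 : forall x, 0 <= g x).
Hypothesis mg : measurable_fun [set: measurableTypeR R] g.
Hypothesis lawX : forall A : set (measurableTypeR R), measurable A ->
  P (X @^-1` A) = (\int[mu]_(x in A) (g x)%:E)%E.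

Let XRV : {RV P >-> measurableTypeR R} := mfun_Sub (mem_set mX).

Let distributionE (f : measurableTypeR R -> \bar R) : measurable_fun [set: _] f ->
  (\int[distribution P XRV]_x f x = \int[mu]_x (f x * (g x)%:E))%E.
Proof.
move=> mf; apply: (@integral_density _ _ R mu (distribution P XRV) setT g) => //.
by move=> B mB; rewrite setIT; exact: lawX.
Qed.

Lemma integrable_law_density (f : R -> R) : measurable_fun [set: measurableTypeR R] f ->
  mu.-integrable [set: R] (fun x => (f x * g x)%:E) ->
  P.-integrable [set: T] (fun t => (f (X t))%:E).
Proof.
move=> mf /integrableP[_ ifg]; apply/integrableP; split.
  by apply/measurable_EFinP; exact: measurableT_comp.
have mfE : measurable_fun [set: measurableTypeR R] (fun x => `|(f x)%:E|%E).
  by apply: measurableT_comp => //; exact/measurable_EFinP.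
have := @ge0_integral_distribution _ _ _ _ _ P XRV (fun x => `|(f x)%:E|%E) mfE.
move=> /(_ (fun=> abse_ge0 _)) /= <-; rewrite distributionE //.
apply: le_lt_trans ifg; rewrite le_eqVlt; apply/orP; left; apply/eqP.
by apply: eq_integral => x _; rewrite /= normrM (ger0_norm (g0 x)).
Qed.

Lemma Rintegral_law_density (f : R -> R) : measurable_fun [set: measurableTypeR R] f ->
  mu.-integrable [set: R] (fun x => (f x * g x)%:E) ->
  \int[P]_t f (X t) = \int[mu]_x (f x * g x).
Proof.
move=> mf ifg; rewrite /Rintegral; congr fine.
have mfE : measurable_fun [set: measurableTypeR R] (fun x => (f x)%:E).
  exact/measurable_EFinP.
have := @integral_distribution _ _ _ _ _ P XRV (fun x => (f x)%:E) mfE.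
move=> /(_ (integrable_law_density mf ifg)) /= <-.
by rewrite distributionE.
Qed.

End law_with_density.

Section whole_line.
Variable R : realType.
Local Notation mu := (@lebesgue_measure R).

(** A bound [C / `|x|] on the primitive kills the boundary terms. *)
Lemma Rintegral_derivative_line (f F : R -> R) (C : R) :
  continuous f -> continuous F -> (forall x : R, is_derive x 1 F (f x)) ->
  mu.-integrable [set: R] (EFin \o f) -> (forall x, `|x| * `|F x| <= C) ->
  \int[mu]_x f x = 0.
Proof.
move=> cf cF dF intf FC.
pose A (n : nat) : set R := `[- n.+1%:R, n.+1%:R]%classic.
have mA n : measurable (A n) by exact: measurable_itv.
have E n : \int[mu]_x (f x * \1_(A n) x) = F n.+1%:R - F (- n.+1%:R).
  have nn : - n.+1%:R < n.+1%:R :> R by have : 0 < n.+1%:R :> R by []; lra.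
  rewrite -(Rintegral_derivative nn cf cF (fun x _ => dF x)) [RHS]Rintegral_mkcond.
  apply: eq_Rintegral => x _; rewrite patchE indicE /A.
  by case: (_ \in _); rewrite ?mulr1 ?mulr0.
have cvg1 : \int[mu]_x (f x * \1_(A n) x) @[n --> \oo] --> \int[mu]_x f x.
  apply: (@cvg_Rintegral_dominated _ _ _ mu _ _ (fun x => `|f x|)).
  - move=> n; apply: measurable_funM; first exact: continuous_measurable_fun.
    by apply: measurable_indic; exact: mA.
  - exact: continuous_measurable_fun.
  - move=> x; apply: cvg_near_cst; near=> n.
    rewrite indicE mem_set ?mulr1 // /A /= in_itv /= -ler_norml.
    have : (Num.truncn `|x| <= n)%N by near: n; exact: nbhs_infty_ge.
    by rewrite truncn_le_nat => /ltW.
  - exact: (integrable_norm intf).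
  - move=> n x; rewrite normrM ler_piMr // indicE; case: (_ \in _);
    by rewrite ?normr0 ?normr1.
have cvg2 : \int[mu]_x (f x * \1_(A n) x) @[n --> \oo] --> (0 : R).
  have h0 : 2 * C * n.+1%:R^-1 @[n --> \oo] --> (0 : R).
    by rewrite -(mulr0 (2 * C)); apply: cvgM; [exact: cvg_cst | exact: cvg_harmonic].
  have h1 : - (2 * C * n.+1%:R^-1) @[n --> \oo] --> (0 : R).
    by rewrite -oppr0; apply: cvgN.
  apply: (squeeze_cvgr _ h1 h0).
  near=> n; rewrite E -ler_norml.
  have n0 : 0 < n.+1%:R :> R by rewrite ltr0n.
  have Fn x : `|x| = n.+1%:R -> `|F x| <= C / n.+1%:R.
    by move=> xn; rewrite ler_pdivlMr // mulrC -xn.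
  apply: (le_trans (ler_normB _ _)).
  rewrite -mulrA mulr_natl mulr2n; apply: lerD; apply: Fn.
    by rewrite ger0_norm.
  by rewrite normrN ger0_norm.
exact: (cvg_unique _ cvg1 cvg2).
Unshelve. all: by end_near. Qed.

End whole_line.

Section normal_moments.
Variables (R : realType) (m s : R).
Hypothesis s0 : 0 < s.
Local Notation mu := (@lebesgue_measure R).
Local Notation pdf := (normal_pdf m s).
Local Notation s2 := (Num.sqrt 2 * s).

Let sn0 : s != 0. Proof. by rewrite gt_eqF. Qed.
Let s2_gt0 : 0 < s2. Proof. by rewrite mulr_gt0 // sqrtr_gt0. Qed.

Lemma expR_power_bound k (u : R) : 0 <= u ->
  (1 + u) ^+ k <= k.+1%:R ^+ k * expR u.
Proof.
move=> u0; have k0 : 0 < k.+1%:R :> R by rewrite ltr0n.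
apply: (@le_trans _ _ ((k.+1%:R * expR (u / k.+1%:R)) ^+ k)).
  apply: lerXn2r; rewrite ?nnegrE ?addr_ge0 ?mulr_ge0 ?expR_ge0 //.
  apply: (@le_trans _ _ (k.+1%:R * (1 + u / k.+1%:R))).
    by rewrite mulrDr mulr1 mulrC divfK ?gt_eqF // lerD2r ler1n.
  by rewrite ler_wpM2l // expR_ge1Dx.
rewrite exprMn ler_wpM2l ?exprn_ge0 // -expRM_natr ler_expR.
rewrite -mulrA ler_piMr // mulrC ler_pdivrMr // mul1r ler_nat //.
Qed.

(** Powers of [x] are absorbed by doubling the variance. *)
Lemma normal_pdf_power_bound k : exists2 C : R, 0 <= C &
  forall x, `|x| ^+ k * pdf x <= C * normal_pdf m s2 x.
Proof.
have p0 : 0 < normal_peak s2 by rewrite normal_peak_gt0 // gt_eqF.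
have p1 : 0 <= normal_peak s by exact: normal_peak_ge0.
pose A := 1 + 2 * m ^+ 2 + 8 * s ^+ 2.
have A0 : 0 <= A by rewrite !addr_ge0 // mulr_ge0 // sqr_ge0.
pose B := A ^+ k * k.+1%:R ^+ k.
have B0 : 0 <= B by rewrite mulr_ge0 // exprn_ge0.
exists (B * normal_peak s / normal_peak s2).
  exact: divr_ge0 (mulr_ge0 B0 p1) (ltW p0).
move=> x; pose u := (x - m) ^+ 2 / (4 * s ^+ 2).
have s20 : 0 < s ^+ 2 by rewrite exprn_gt0.
have u0 : 0 <= u by rewrite divr_ge0 ?sqr_ge0 // mulr_ge0 // ltW.
have uE : (x - m) ^+ 2 = 4 * s ^+ 2 * u.
  by rewrite /u mulrC divfK // mulf_neq0 // gt_eqF.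
have pdfE : pdf x = normal_peak s * (expR (- u) * expR (- u)).
  rewrite /normal_pdf (negbTE sn0) /normal_fun -expRD; congr (_ * expR _).
  by rewrite /u; field.
have pdf2E : normal_pdf m s2 x = normal_peak s2 * expR (- u).
  rewrite /normal_pdf gt_eqF // /normal_fun exprMn sqr_sqrtr //.
  by congr (_ * expR _); rewrite /u; field.
have xk : `|x| ^+ k <= B * expR u.
  rewrite /B -mulrA; apply: (@le_trans _ _ ((A * (1 + u)) ^+ k)); last first.
    by rewrite exprMn ler_wpM2l ?exprn_ge0 // expR_power_bound.
  have Au0 : 0 <= A * (1 + u) by apply: mulr_ge0 => //; exact: addr_ge0.
  apply: lerXn2r; rewrite ?nnegrE //.
  apply: (@le_trans _ _ (1 + x ^+ 2)).
    by rewrite -[x ^+ 2]real_normK ?num_real //; move: `|x| => y; nra.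
  have : x ^+ 2 <= 2 * m ^+ 2 + 8 * s ^+ 2 * u.
    rewrite (_ : 8 * s ^+ 2 * u = 2 * (4 * s ^+ 2 * u)); last by ring.
    by rewrite -uE; have := sqr_ge0 (x - 2 * m); lra.
  have h1 : 0 <= 2 * m ^+ 2 by rewrite mulr_ge0 // sqr_ge0.
  have h2 := ltW s20.
  have h3 := mulr_ge0 h1 u0.
  by move=> hx; rewrite /A; lra.
rewrite pdfE pdf2E mulrA.
rewrite [leRHS](_ : _ = B * normal_peak s * expR (- u)); last first.
  by rewrite mulrA divfK // gt_eqF.
have -> : B * normal_peak s * expR (- u) =
    B * expR u * (normal_peak s * (expR (- u) * expR (- u))).
  rewrite (_ : B * expR u * _ = B * normal_peak s * expR (- u) * (expR u * expR (- u))).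
    by rewrite -expRD subrr expR0 mulr1.
  by ring.
by rewrite -mulrA ler_wpM2r // mulr_ge0 // mulr_ge0 // expR_ge0.
Qed.

Lemma integrable_power_normal k :
  mu.-integrable [set: R] (fun x => (x ^+ k * pdf x)%:E).
Proof.
have [C C0 hC] := normal_pdf_power_bound k.
apply: (@le_integrable _ _ _ mu _ measurableT _
  (fun x => (C%:E * (normal_pdf m s2 x)%:E)%E)).
- apply/measurable_EFinP; apply: measurable_funM.
    by apply: continuous_measurable_fun; exact: exprn_continuous.
  exact: measurable_normal_pdf.
- move=> x _; rewrite -EFinM /= lee_fin normrM normrX (ger0_norm (normal_pdf_ge0 _ _ _)).
  by apply: (le_trans (hC x)); exact: ler_norm.
- by apply: integrableZl => //; exact: integrable_normal_pdf.
Qed.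

Definition normal_moment k : R := \int[mu]_x (x ^+ k * pdf x).

Lemma normal_moment0 : normal_moment 0 = 1.
Proof.
rewrite /normal_moment /Rintegral; under eq_integral do rewrite expr0 mul1r.
by rewrite integral_normal_pdf.
Qed.

(** The derivative of [x ^+ k * pdf x] has integral 0. *)
Lemma normal_momentS k :
  normal_moment k.+1 = m * normal_moment k + k%:R * s ^+ 2 * normal_moment k.-1.
Proof.
have s20 : s ^+ 2 != 0 by rewrite expf_neq0.
pose F x := x ^+ k * pdf x.
pose f x := k%:R * (x ^+ k.-1 * pdf x) + (s ^- 2 * m * (x ^+ k * pdf x)
  - s ^- 2 * (x ^+ k.+1 * pdf x)).
have cp : continuous pdf by exact: continuous_normal_pdf.
have cXp j : continuous (fun x : R => x ^+ j * pdf x).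
  by apply: continuous_mul; [exact: continuous_X | exact: cp].
have cZ c (h : R -> R) : continuous h -> continuous (fun x : R => c * h x).
  by apply: continuous_mul; exact: continuous_const.
have cf : continuous f.
  apply: continuous_add; first exact: cZ.
  by apply: continuous_sub; exact: cZ.
have dpdf (x : R) : is_derive x 1 pdf (- (x - m) / s ^+ 2 * pdf x).
  have pE : pdf = fun x => normal_peak s * expR (- (x - m) ^+ 2 / (s ^+ 2 *+ 2)).
    by apply/funext => y; rewrite /normal_pdf (negbTE sn0).
  have dg : is_derive x 1 (fun y : R => - (y - m) ^+ 2 / (s ^+ 2 *+ 2))
      (- (x - m) / s ^+ 2).
    by apply: is_derive_eq; rewrite /GRing.scale /=; field.
  have de := @is_derive1_comp _ expR _ x _ _ (is_derive_expR _) dg.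
  rewrite pE.
  have := is_deriveM (is_derive_cst (normal_peak s) x 1) de => /is_derive_eq; apply.
  by rewrite /GRing.scale /=; ring.
have dF (x : R) : is_derive x 1 F (f x).
  have dX : is_derive x 1 (fun y : R => y ^+ k) (k%:R * x ^+ k.-1).
    have := is_deriveX k (is_derive_id x 1); rewrite exprfctE => /is_derive_eq.
    by apply; rewrite /GRing.scale /= mulr1.
  have := is_deriveM dX (dpdf x) => /is_derive_eq; apply.
  by rewrite /f /GRing.scale /= [x ^+ k.+1]exprS; field.
have iXp j : mu.-integrable [set: R] (EFin \o (fun x => x ^+ j * pdf x)).
  exact: integrable_power_normal.
have iZ c j : mu.-integrable [set: R] (EFin \o (fun x => c * (x ^+ j * pdf x))).
  exact: (integrableZl measurableT c (iXp j)).
have iB : mu.-integrable [set: R] (EFin \o (fun x => s ^- 2 * m * (x ^+ k * pdf x)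
    - s ^- 2 * (x ^+ k.+1 * pdf x))).
  exact: (integrableB measurableT (iZ _ _) (iZ _ _)).
have intf : mu.-integrable [set: R] (EFin \o f).
  exact: (integrableD measurableT (iZ _ _) iB).
have [C C0 hC] := normal_pdf_power_bound k.+1.
have FC x : `|x| * `|F x| <= C * normal_peak s2.
  rewrite normrM normrX (ger0_norm (normal_pdf_ge0 _ _ _)) mulrA -exprS.
  apply: (le_trans (hC x)); rewrite ler_wpM2l // normal_pdf_ub // gt_eqF //.
have cF : continuous F by exact: cXp.
have := Rintegral_derivative_line cf cF dF intf FC.
rewrite /f RintegralD // RintegralB //.
rewrite !RintegralZl //; try exact: iXp.
rewrite -!/(normal_moment _) => /eqP.
rewrite addr_eq0 => /eqP e.
apply: (@mulfI _ (s ^- 2)); first by rewrite invr_eq0.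
rewrite mulrDr (_ : s ^- 2 * (k%:R * _ * _) = k%:R * normal_moment k.-1).
  by rewrite e; ring.
by field.
Qed.

End normal_moments.

Section gaussian_moments.
Context {d : measure_display} {T : measurableType d} {R : realType}.
Variable P : probability T R.
Local Notation mu := (@lebesgue_measure R).

Let mpow k : measurable_fun [set: measurableTypeR R] (fun x : R => x ^+ k).
Proof. by apply: continuous_measurable_fun; exact: exprn_continuous. Qed.

Let finite_moments_pow (X : T -> measurableTypeR R) : measurable_fun [set: T] X ->
  (forall k, P.-integrable [set: T] (fun t => (X t ^+ k)%:E)) -> finite_moments P X.
Proof.
move=> mX iX; split=> // k.
have /integrable_norm := iX k; apply: eq_integrable => // t _ /=.
by rewrite normrX.
Qed.

Let dirac_moments (X : T -> measurableTypeR R) (m : R) : measurable_fun [set: T] X ->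
  (forall A : set (measurableTypeR R), measurable A -> P (X @^-1` A) = \d_m A) ->
  finite_moments P X /\ forall k, \int[P]_t (X t ^+ k) = m ^+ k.
Proof.
move=> mX lawX; pose XRV : {RV P >-> measurableTypeR R} := mfun_Sub (mem_set mX).
have distE (F : measurableTypeR R -> \bar R) : measurable_fun [set: _] F ->
    (\int[distribution P XRV]_x F x = F m)%E.
  move=> mF; transitivity (\int[\d_(m : measurableTypeR R)]_x F x)%E.
    by apply: eq_measure_integral => A mA _; exact: lawX.
  by rewrite integral_dirac // diracT mul1e.
have iX k : P.-integrable [set: T] (fun t => (X t ^+ k)%:E).
  have mk : measurable_fun [set: measurableTypeR R] (fun x : R => (x ^+ k)%:E).
    exact/measurable_EFinP.
  apply/integrableP; split; first exact: (measurableT_comp mk mX).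
  have mn : measurable_fun [set: measurableTypeR R] (fun x : R => `|(x ^+ k)%:E|%E).
    exact: measurableT_comp.
  have := @ge0_integral_distribution _ _ _ _ _ P XRV _ mn.
  by move=> /(_ (fun=> abse_ge0 _)) /= <-; rewrite distE // ltry.
split; first exact: finite_moments_pow.
move=> k; rewrite /Rintegral.
have mk : measurable_fun [set: measurableTypeR R] (fun x : R => (x ^+ k)%:E).
  exact/measurable_EFinP.
have := @integral_distribution _ _ _ _ _ P XRV _ mk (iX k).
by move=> /= <-; rewrite distE.
Qed.

Let normal_law_moments (X : T -> measurableTypeR R) (m s : R) : 0 < s -> measurable_fun [set: T] X ->
  (forall A : set (measurableTypeR R), measurable A ->
     P (X @^-1` A) = normal_prob m s A) ->
  finite_moments P X /\ forall k, \int[P]_t (X t ^+ k) = normal_moment m s k.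
Proof.
move=> s0 mX lawX.
have mp := @measurable_normal_pdf R m s.
have ip k := integrable_power_normal m s0 k.
split=> [|k].
  apply: finite_moments_pow => // k.
  exact: (integrable_law_density mX (normal_pdf_ge0 m s) mp lawX (@mpow k) (ip k)).
exact: (Rintegral_law_density mX (normal_pdf_ge0 m s) mp lawX (@mpow k) (ip k)).
Qed.

Lemma gaussian_finite_moments (X : T -> R) : gaussian_rv P X -> finite_moments P X.
Proof.
move=> [mX [[m [s [s0 lawX]]]|[m lawX]]].
  by have [] := normal_law_moments s0 mX lawX.
by have [] := dirac_moments mX lawX.
Qed.

(** Integration by parts for one centred Gaussian variable; it includes the
    degenerate case [v = 0]. *)
Lemma centred_gaussian_moments (X : T -> R) (v : R) : gaussian_rv P X ->
  \int[P]_t X t = 0 -> \int[P]_t (X t ^+ 2) = v ->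
  forall k, \int[P]_t (X t ^+ k.+1) = k%:R * v * \int[P]_t (X t ^+ k.-1).
Proof.
move=> [mX [[m [s [s0 lawX]]]|[m lawX]]] X1 X2 k.
  have [_ mE] := normal_law_moments s0 mX lawX.
  have e0 := normal_moment0 m s.
  have e1 := normal_momentS m s0 0; have e2 := normal_momentS m s0 1.
  have m0 : m = 0.
    move: X1; rewrite (_ : \int[P]_t X t = normal_moment m s 1).
      by rewrite e1 e0 !mul0r addr0 mulr1.
    by rewrite -mE; apply: eq_Rintegral => t _; rewrite expr1.
  have vE : v = s ^+ 2 by rewrite -X2 mE e2 /= e0 m0 mul0r add0r mul1r mulr1.
  by rewrite !mE normal_momentS // m0 vE mul0r add0r.
have [_ mE] := dirac_moments mX lawX.
have m0 : m = 0.
  rewrite -X1 -[m]expr1 -mE; apply: eq_Rintegral => t _; by rewrite expr1.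
by rewrite -X2 !mE m0 !expr0n /= mulr0 mul0r.
Qed.

End gaussian_moments.

Section complex_gaussian_moments.
Context {d : measure_display} {T : measurableType d} {R : realType}.
Variable P : probability T R.
Local Notation rv := (momentRV P).
Local Notation E := (@expect _ _ _ P).

Lemma complex_gaussian_finite_moments (Z : T -> R[i]) :
  complex_gaussian_rv P Z -> Z \in complex_finite_moments P.
Proof.
move=> [_ gZ]; apply/complex_finite_momentsP; split.
  have := gaussian_finite_moments (gZ 1 0).
  by under eq_fun do rewrite mul1r mul0r addr0.
have := gaussian_finite_moments (gZ 0 1).
by under eq_fun do rewrite mul1r mul0r add0r.
Qed.

Lemma expect_real (X : rv) (f : T -> R) : (forall t, X t = (f t)%:C) ->
  E X = (\int[P]_t f t)%:C.
Proof.
move=> XE; rewrite /expect /cexpectation; congr (_ +i* _).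
  by apply: eq_Rintegral => t _; rewrite XE.
by under eq_Rintegral do rewrite XE /=; rewrite Rintegral_cst // mul0r.
Qed.

Lemma expect_real_gaussian (X : rv) (f : T -> R) (v : R[i]) :
  (forall t, X t = (f t)%:C) -> gaussian_rv P f -> E X = 0 -> E (X ^+ 2) = v ->
  forall k, E (X ^+ k.+1) = v * k%:R * E (X ^+ k.-1).
Proof.
move=> XE gf EX EX2 k.
have XkE j t : (X ^+ j) t = (f t ^+ j)%:C.
  by rewrite -[LHS]/(rv_eval t (X ^+ j)) rmorphXn /= /rv_eval XE rmorphXn.
have f1 : \int[P]_t f t = 0.
  by move: EX; rewrite (expect_real XE) => -[].
rewrite -EX2 !(expect_real (XkE _)).
rewrite (centred_gaussian_moments gf f1 erefl).
by rewrite -(rmorph_nat (real_complex R)) -!rmorphM; congr (_%:C); rewrite (mulrC k%:R).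
Qed.

End complex_gaussian_moments.

(** * Moments of a circular complex Gaussian variable *)

Section unit_circle.
Variable R : realType.

Lemma poly_eq0_unit_circle (p : {poly R[i]}) :
  (forall z : R[i], z * z^*%C = 1 -> p.[z] = 0) -> p = 0.
Proof.
move=> hp; apply/eqP/negPn/negP => p0.
(* a rational parametrization of the circle *)
pose z (t : nat) : R[i] := (1 +i* t%:R) / (1 -i* t%:R).
have d0 (t : nat) : 1 -i* t%:R != 0 :> R[i].
  by rewrite eq_complex /= negb_and oner_eq0.
have n0 (t : nat) : 1 +i* t%:R != 0 :> R[i].
  by rewrite eq_complex /= negb_and oner_eq0.
have z1 t : z t * (z t)^*%C = 1.
  have -> : (z t)^*%C = (1 -i* t%:R) / (1 +i* t%:R).
    by rewrite /z fmorph_div [in RHS]/GRing.inv /= ?opprK.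
  by rewrite /z mulrA divfK // divff.
have z_inj : injective z.
  move=> t u /eqP; rewrite /z eqr_div //.
  rewrite eq_complex /= => /andP[_ /eqP h]; apply/eqP.
  rewrite -(eqr_nat R); apply/eqP; move: h.
  by move: (t%:R : R) (u%:R : R) => x y; lra.
have := @max_poly_roots _ p [seq z t | t <- iota 0 (size p)] p0.
rewrite size_map size_iota ltnn => h; suff : false by [].
apply: h; last by rewrite map_inj_uniq // iota_uniq.
by apply/allP => _ /mapP[t _ ->]; apply/eqP; exact: hp.
Qed.

End unit_circle.

Lemma two_step_recursion_unique (K : pzRingType) (c e e' : nat -> K) :
  c 0%N = 0 -> e 0%N = e' 0%N -> (forall k, e k.+1 = c k * e k.-1) ->
  (forall k, e' k.+1 = c k * e' k.-1) -> forall n, e n = e' n.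
Proof.
move=> c0 e0 eS e'S n; have [N] := ubnP n.
elim: N n => // N IH [|[|n]] hn //; rewrite eS e'S; first by rewrite c0 !mul0r.
by congr (_ * _); apply: IH; rewrite ltnS in hn; exact: ltnW hn.
Qed.

(** The real linear forms of a circular variable [Z] are Gaussian with one common
    variance, so that the mean of the [n]-th power of [z^* * Z + z * Z^*] is the same
    for all [z] on the unit circle.  Times [z ^+ n], it is a polynomial in [z];
    comparing coefficients gives the mixed moments of [Z] and its conjugate. *)
Section circular_moments.
Context {d : measure_display} {T : measurableType d} {R : realType}.
Variable P : probability T R.
Local Notation rv := (momentRV P).
Local Notation E := (@expect _ _ _ P).
Local Notation cst := (rv_cst P).

Variables (Z Zc : rv) (v : R[i]).
Hypothesis ZcE : forall t, Zc t = (Z t)^*%C.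
Hypothesis Z_gaussian : complex_gaussian_rv P Z.
Hypothesis EZ : E Z = 0.
Hypothesis EZc : E Zc = 0.
Hypothesis EZZ : E (Z * Z) = 0.
Hypothesis EZcZc : E (Zc * Zc) = 0.
Hypothesis EZZc : E (Z * Zc) = v.

Let Y (z : R[i]) : rv := cst z^*%C * Z + cst z * Zc.

Let Y_moments z k : z * z^*%C = 1 ->
  E (Y z ^+ k.+1) = 2 * v * k%:R * E (Y z ^+ k.-1).
Proof.
move=> z1.
apply: (@expect_real_gaussian _ _ _ _ _ (fun t =>
  2 * complex.Re z * complex.Re (Z t) + 2 * complex.Im z * complex.Im (Z t))).
- move=> t; rewrite /Y rvD !rvM /= ZcE.
  by case: z {z1} => a b; case: (Z t) => x y /=; apply/eqP; rewrite eq_complex /=;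
    apply/andP; split; apply/eqP; ring.
- by case: Z_gaussian.
- by rewrite /Y raddfD /= !expect_cst_mul EZ EZc !mulr0 addr0.
- have -> : Y z ^+ 2 = cst (z^*%C ^+ 2) * (Z * Z) + cst (2 * (z * z^*%C)) * (Z * Zc)
      + cst (z ^+ 2) * (Zc * Zc).
    by rewrite /Y; rewrite !rmorphXn !rmorphM /= rmorph_nat; ring.
  by rewrite !raddfD /= !expect_cst_mul EZZ EZcZc EZZc z1; ring.
Qed.

Let g n : R[i] := E (Y 1 ^+ n).

Let Y_momentsE n z : z * z^*%C = 1 -> E (Y z ^+ n) = g n.
Proof.
move=> z1; have o1 : 1 * (1 : R[i])^*%C = 1 by rewrite rmorph1 mulr1.
apply: (@two_step_recursion_unique _ (fun k => 2 * v * k%:R)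
  (fun k => E (Y z ^+ k)) g).
- by rewrite mulr0.
- by rewrite /g (expr0 (Y z)) (expr0 (Y 1)).
- by move=> k; exact: Y_moments.
- by move=> k; exact: Y_moments.
Qed.

Let c a b := E (Z ^+ a * Zc ^+ b).

Let circular a b : 'C(a + b, b)%:R * c a b = if a == b then g (a + b) else 0.
Proof.
pose n := (a + b)%N.
pose p : {poly R[i]} :=
  \sum_(i < n.+1) ('C(n, i)%:R * c (n - i) i) *: 'X^(i.*2) - g n *: 'X^n.
have p0 : p = 0.
  apply: poly_eq0_unit_circle => z z1; rewrite /p !hornerE horner_sum.
  apply/eqP; rewrite subr_eq0 -(Y_momentsE n z1) mulrC -expect_cst_mul /Y.
  rewrite exprDn mulr_sumr raddf_sum /=; apply/eqP; apply: eq_bigr => i _.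
  rewrite !hornerE.
  have ni : (i <= n)%N by rewrite -ltnS.
  rewrite !exprMn mulrnAr raddfMn /=.
  have -> : cst (z ^+ n) * (cst z^*%C ^+ (n - i) * Z ^+ (n - i) * (cst z ^+ i * Zc ^+ i))
      = cst (z ^+ i.*2) * (Z ^+ (n - i) * Zc ^+ i).
    have -> : z ^+ i.*2 = z ^+ n * z^*%C ^+ (n - i) * z ^+ i.
      have zn : z ^+ n = z ^+ (n - i) * z ^+ i by rewrite -exprD subnK.
      have zz : z ^+ (n - i) * z^*%C ^+ (n - i) = 1 by rewrite -exprMn z1 expr1n.
      rewrite zn -addnn exprD -[LHS]mul1r -zz.
      by ring.
    by rewrite !rmorphM !rmorphXn /=; ring.
  by rewrite expect_cst_mul /c -mulr_natr; ring.
have := congr1 (fun q : {poly R[i]} => q`_(b.*2)) p0.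
rewrite /p coefB coef_sum coefZ coefXn coef0.
have bn : (b < n.+1)%N by rewrite /n; lia.
rewrite (bigD1 (Ordinal bn)) //= coefZ coefXn eqxx mulr1 big1 ?addr0; last first.
  move=> i ib; rewrite coefZ coefXn (_ : (b.*2 == i.*2) = false) ?mulr0 //.
  apply/negP => /eqP e; move/eqP: ib; apply; apply: val_inj => /=.
  by move: e; lia.
have nb : (n - b)%N = a by rewrite /n addnK.
have bE : (b.*2 == n) = (a == b) by rewrite /n -addnn eqn_add2r eq_sym.
rewrite nb bE => /eqP; rewrite subr_eq0 => /eqP ->.
by case: (a == b); rewrite ?mulr1 ?mulr0.
Qed.

Lemma circular_gaussian_moments a b :
  E (Z ^+ a.+1 * Zc ^+ b) = v * b%:R * E (Z ^+ a * Zc ^+ b.-1).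
Proof.
have bin0 j k : (k <= j)%N -> 'C(j, k)%:R != 0 :> R[i].
  by move=> kj; rewrite pnatr_eq0 -lt0n bin_gt0.
case: b => [|b].
  rewrite mulr0 mul0r; have := circular a.+1 0; rewrite /= /c => /eqP.
  by rewrite mulf_eq0 (negbTE (bin0 _ _ _)) //= => /eqP.
rewrite -/(c a.+1 b.+1) -/(c a b) /=.
have := circular a.+1 b.+1; have := circular a b; rewrite eqSS.
case: eqP => [<-|_] h1 h2; last first.
  move: h1 h2 => /eqP; rewrite mulf_eq0 (negbTE (bin0 _ _ _)) ?leq_addl //= => /eqP ->.
  move=> /eqP; rewrite mulf_eq0 (negbTE (bin0 _ _ _)) ?leq_addl //= => /eqP ->.
  by rewrite mulr0.
have gS : g (a.+1 + a.+1) = 2 * v * (a + a).+1%:R * g (a + a).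
  have -> : (a.+1 + a.+1)%N = (a + a).+2 by rewrite addSn addnS.
  by apply: Y_moments; rewrite rmorph1 mulr1.
apply: (mulfI (bin0 (a.+1 + a.+1)%N a.+1 (leq_addl _ _))).
rewrite h2 gS -h1.
have binE : (a.+1 * 'C(a.+1 + a.+1, a.+1) = 2 * (a + a).+1 * 'C(a + a, a))%N.
  rewrite addSn -mul_bin_diag /= addnS.
  have e : ((a + a).+1 * 'C(a + a, a) = a.+1 * 'C((a + a).+1, a))%N.
    have := mul_bin_diag (a + a).+1 a; rewrite /= => ->; congr (_ * _)%N.
    by rewrite -bin_sub; [congr 'C(_, _); lia | lia].
  by rewrite -[(2 * _ * _)%N]mulnA e; lia.
have := congr1 (fun k => k%:R : R[i]) binE; rewrite !natrM => be.
rewrite -[in RHS]mulrA [v * _]mulrC !mulrA [_ * a.+1%:R]mulrC be; ring.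
Qed.

End circular_moments.

(** * Traces of powers and eigenvalues *)

Section trace_eigenvalues.
Variable R : realType.

(** The matrix over polynomials is conjugated along with the matrix. *)
Lemma char_poly_conj (K : fieldType) n (Q D : 'M[K]_n) : Q \in unitmx ->
  char_poly (invmx Q *m D *m Q) = char_poly D.
Proof.
move=> Qu; pose f := map_mx (@polyC K).
have QQ : f _ _ (invmx Q) *m f _ _ Q = 1%:M.
  by rewrite /f -map_mxM mulVmx // map_mx1.
rewrite /char_poly; have -> : char_poly_mx (invmx Q *m D *m Q) =
    f _ _ (invmx Q) *m char_poly_mx D *m f _ _ Q.
  rewrite /char_poly_mx !map_mxM mulmxBr mulmxBl /f; congr (_ - _).
  by rewrite scalar_mxC -mulmxA -/f QQ mulmx1.
rewrite !det_mulmx mulrAC -det_mulmx QQ det1 mul1r //.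
Qed.

Lemma conj_diag_power (K : fieldType) n (Q : 'M[K]_n) (D : 'rV[K]_n) k :
  Q \in unitmx -> (invmx Q *m diag_mx D *m Q) ^+ k =
  invmx Q *m diag_mx (\row_j D 0 j ^+ k) *m Q.
Proof.
move=> Qu; elim: k => [|k IH].
  rewrite expr0 (_ : diag_mx _ = 1%:M) ?mulmx1 ?mulVmx //.
  by apply/matrixP => i j; rewrite !mxE expr0.
have -> : \row_j D 0 j ^+ k.+1 = \row_j (D 0 j * (\row_i D 0 i ^+ k) 0 j).
  by apply/rowP => j; rewrite !mxE exprS.
rewrite -mulmx_diag exprS IH -mulmxE; move: (diag_mx _) (diag_mx _) => A B.
by rewrite !mulmxA (mulmxK Qu).
Qed.

(** The spectral theorem diagonalizes the matrix; unique factorization identifies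
    the diagonal entries with the roots of the characteristic polynomial. *)
Lemma trace_power_eigenvalues n (M : 'M[R[i]]_n) k : hermitian_mx M ->
  \tr (M ^+ k) = \sum_(z <- eigenvalues M) z ^+ k.
Proof.
move=> hM.
have nM : M \is normalmx.
  apply/normalmxP; congr (_ *m _); first apply/matrixP => i j.
    by rewrite !mxE hM.
  by apply/matrixP => i j; rewrite !mxE [RHS]hM.
have /orthomx_spectralP ME := nM.
set Q := spectralmx M in ME; set D := spectral_diag M in ME.
have Qu : Q \in unitmx by exact: spectral_unit.
have MkE := conj_diag_power (spectral_diag M) k Qu.
rewrite -/D -ME in MkE.
have eE : perm_eq (eigenvalues M) [seq D 0 j | j <- enum 'I_n].
  apply: prod_XsubC_eq; rewrite -char_poly_eigenvalues {1}ME char_poly_conj //.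
  rewrite char_poly_trig; last exact: diag_mx_is_trig.
  by rewrite big_map big_enum; apply: eq_bigr => i _; rewrite mxE eqxx mulr1n.
rewrite (perm_big _ eE) big_map big_enum /= MkE mxtrace_mulC mulmxA mulmxV // mul1mx.
by rewrite mxtrace_diag; apply: eq_bigr => i _; rewrite mxE.
Qed.

Lemma trace_power_real_eigenvalues n (M : 'M[R[i]]_n) k : hermitian_mx M ->
  \tr (M ^+ k) = (\sum_(x <- [seq complex.Re z | z <- eigenvalues M]) x ^+ k)%:C.
Proof.
move=> hM; rewrite trace_power_eigenvalues // rmorph_sum big_map /=.
rewrite big_seq [RHS]big_seq; apply: eq_bigr => z zM.
by rewrite {1}(hermitian_eigenvalue_real hM zM) rmorphXn.
Qed.

Lemma integral_eigenvalue_measure n (M : 'M[R[i]]_n) (f : R -> R) :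
  continuous f ->
  (\int[eigenvalue_measure M]_x (f x)%:E =
   (n%:R^-1 * \sum_(x <- [seq complex.Re z | z <- eigenvalues M]) f x)%:E)%E.
Proof.
move=> cf.
have mf : measurable_fun [set: measurableTypeR R] f by exact: continuous_measurable_fun.
have pos (g : R -> R) : measurable_fun [set: measurableTypeR R] g ->
    (forall x, 0 <= g x) -> (\int[eigenvalue_measure M]_x (g x)%:E =
   (n%:R^-1 * \sum_(x <- [seq complex.Re z | z <- eigenvalues M]) g x)%:E)%E.
  move=> mg g0; have mgE : measurable_fun [set: measurableTypeR R] (fun x => (g x)%:E).
    exact/measurable_EFinP.
  have g0E (x : measurableTypeR R) : [set: _] x -> (0 <= (g x)%:E)%E by rewrite lee_fin.
  pose dirac_z (k : nat) : {measure set (measurableTypeR R) -> \bar R} :=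
    \d_(complex.Re (eigenvalues M)`_k : measurableTypeR R).
  rewrite /eigenvalue_measure.
  rewrite (@ge0_integral_mscale _ _ R (msum dirac_z n) _ measurableT _ _ mgE g0E).
  rewrite (@ge0_integral_measure_sum _ _ R dirac_z _ measurableT _ g0E mgE) EFinM.
  congr (_ * _)%E; rewrite big_map (big_nth 0) size_eigenvalues big_mkord -sumEFin.
  by apply: eq_bigr => k _; rewrite integral_dirac // diracT mul1e.
rewrite integralE.
have -> : (\int[eigenvalue_measure M]_x (fun x => (f x)%:E)^\+ x)%E =
    (\int[eigenvalue_measure M]_x (Num.max (f x) 0)%:E)%E.
  by apply: eq_integral => x _; rewrite funeposE -EFin_max.
have -> : (\int[eigenvalue_measure M]_x (fun x => (f x)%:E)^\- x)%E =
    (\int[eigenvalue_measure M]_x (Num.max (- f x) 0)%:E)%E.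
  by apply: eq_integral => x _; rewrite funenegE -EFinN -EFin_max.
have mp : measurable_fun [set: measurableTypeR R] (fun x => Num.max (f x) 0).
  by apply: measurable_maxr => //; exact: measurable_cst.
have mn : measurable_fun [set: measurableTypeR R] (fun x => Num.max (- f x) 0).
  by apply: measurable_maxr; [exact: measurableT_comp | exact: measurable_cst].
rewrite !pos //; last 2 first.
- by move=> x; rewrite le_max lexx orbT.
- by move=> x; rewrite le_max lexx orbT.
rewrite -EFinB; congr EFin; rewrite -mulrBr -sumrB; congr (_ * _).
apply: eq_bigr => x _; case: (leP (f x) 0) => h.
  by rewrite max_l ?oppr_ge0 // sub0r opprK.
by rewrite max_r ?subr0 // oppr_le0 ltW.
Qed.

End trace_eigenvalues.

(** * Almost sure convergence from summable second moments *)

Section almost_sure.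
Context {d : measure_display} {T : measurableType d} {R : realType}.
Variable P : probability T R.

Lemma sum_inverse_square_le n :
  \sum_(0 <= i < n) (i.+1%:R ^- 2 : R) <= 2.
Proof.
suff h : \sum_(0 <= i < n) (i.+1%:R ^- 2 : R) <= 2 - 2 / n.+1%:R.
  by apply: (le_trans h); rewrite gerBl divr_ge0.
elim: n => [|n IH]; first by rewrite big_nil divr1 subrr.
rewrite big_nat_recr //=; apply: (le_trans (lerD IH (lexx _))).
have n1 : 0 < n.+1%:R :> R by []; have n2 : 0 < n.+2%:R :> R by [].
rewrite -subr_ge0 (_ : _ - _ = (2 * n.+1%:R - n.+2%:R) / (n.+1%:R ^+ 2 * n.+2%:R)).
  by apply: divr_ge0; rewrite ?mulr_ge0 ?exprn_ge0 // -natrM -natrB ?ler0n //; lia.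
rewrite -[n.+2%:R]natr1 -[n.+1%:R]natr1 in n1 n2 *.
by move: (n%:R : R) n1 n2 => N n1 n2; field; rewrite !gt_eqF.
Qed.

(** The sum of the squares has a finite integral, so it is finite almost
    everywhere, and then its terms tend to 0. *)
Lemma ae_cvg_square_rate (D : nat -> T -> R) (C : R) :
  (forall n, finite_moments P (D n)) ->
  (forall n, (0 < n)%N -> \int[P]_t (D n t ^+ 2) <= C / n%:R ^+ 2) ->
  {ae P, forall t, D n t @[n --> \oo] --> (0 : R)}.
Proof.
move=> fD hD.
pose f n t := ((D n.+1 t) ^+ 2)%:E.
have mf n : measurable_fun [set: T] (f n).
  by apply/measurable_EFinP; apply: measurable_funX; case: (fD n.+1).
have f0 n t : (0 <= f n t)%E by rewrite lee_fin sqr_ge0.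
have if_ n : (\int[P]_t f n t = (\int[P]_t (D n.+1 t ^+ 2))%:E)%E.
  rewrite /Rintegral fineK //; apply: integrable_fin_num => //.
  have := finite_moments_integrable (finite_momentsM (fD n.+1) (fD n.+1)).
  by apply: eq_integrable => // t _ /=; rewrite expr2.
have sumf : (\sum_(0 <= n <oo) \int[P]_t f n t <= (C * 2)%:E)%E.
  apply: lime_le; first by apply: is_cvg_nneseries => n _ _; exact: integral_ge0.
  apply: nearW => n; under eq_bigr do rewrite if_.
  rewrite sumEFin lee_fin.
  apply: (@le_trans _ _ (\sum_(0 <= i < n) C * i.+1%:R ^- 2)).
    by apply: ler_sum => i _; exact: hD.
  have C0 : 0 <= C.
    have := hD 1 isT; rewrite expr1n divr1; apply: le_trans.
    by apply: Rintegral_ge0 => t _; exact: sqr_ge0.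
  by rewrite -mulr_sumr ler_wpM2l // sum_inverse_square_le.
have iF : P.-integrable [set: T] (fun t => \sum_(0 <= n <oo) f n t)%E.
  apply/integrableP; split.
    by apply: ge0_emeasurable_sum => // n t _ _.
  under eq_integral => t _ do rewrite gee0_abs ?nneseries_ge0 //.
  rewrite integral_nneseries //; apply: le_lt_trans sumf _; exact: ltry.
have := integrable_ae measurableT iF.
apply: filterS => t /(_ I) ft.
have cvgs : cvgn (series (fun n => D n.+1 t ^+ 2)).
  apply: nnseries_is_cvg => [n|]; first exact: sqr_ge0.
  by rewrite ltey_eq ft.
have /cvgrPdist_lt cvg0 := cvg_series_cvg_0 cvgs.
rewrite -(cvg_shiftS); apply/cvgrPdist_lt => e e0.
have := cvg0 (e ^+ 2) (exprn_gt0 2 e0); apply: filterS => n.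
rewrite /= !sub0r !normrN normrX => h.
by rewrite -(ltr_pXn2r (n := 2)) ?nnegrE // ltW.
Qed.

End almost_sure.

(** * The Gaussian unitary ensemble *)

Section gaussian_unitary_ensemble.
Context {R : realType} {d : measure_display} {T : measurableType d}.
Variables (P : probability T R) (w : R).
Hypothesis w_gt0 : 0 < w.
Variable W : nat -> nat -> T -> R[i].
Hypothesis W_hermitian : forall (j k : nat) (t : T), W j k t = (W k j t)^*%C.
Hypothesis W_gaussian : forall j k : nat, complex_gaussian_rv P (W j k).
Hypothesis W_independent : mutually_independent P
  [set jk : nat * nat | (jk.1 <= jk.2)%N] (fun jk => W jk.1 jk.2).
Hypothesis W_mean : forall j k : nat, cexpectation P (W j k) = 0.
Hypothesis W_covariance : forall j k l m : nat,
  cexpectation P (fun t => W j k t * (W l m t)^*%C) =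
  (2 * w ^+ 2 * (j == l)%:R * (k == m)%:R)%:C.

Local Notation E := (@expect _ _ _ P).
Let v : R[i] := (2 * w ^+ 2)%:C.

Let W_moments j k : W j k \in complex_finite_moments P.
Proof. exact: complex_gaussian_finite_moments. Qed.

Let X := entry W_moments.

Let EX p : E (X p) = 0. Proof. exact: W_mean. Qed.

Let EXX p q : E (X p * X q) = v * (p.1 == q.2)%:R * (p.2 == q.1)%:R.
Proof.
have := W_covariance p.1 p.2 q.2 q.1.
rewrite /v !rmorphM /= !rmorph_nat => <-; congr (cexpectation P _).
by apply/funext => t; rewrite -W_hermitian.
Qed.

Let XT p t : X (transpose p) t = (X p t)^*%C.
Proof. exact: W_hermitian. Qed.

Let offdiagonal p a b : p.1 <> p.2 -> E (X p ^+ a.+1 * X (transpose p) ^+ b) =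
  v * b%:R * E (X p ^+ a * X (transpose p) ^+ b.-1).
Proof.
move=> /eqP p12; have p21 : p.2 != p.1 by rewrite eq_sym.
apply: (circular_gaussian_moments (XT p)).
- exact: W_gaussian.
- exact: EX.
- exact: EX.
- by rewrite EXX (negbTE p12) mulr0 mul0r.
- by rewrite EXX /= (negbTE p21) mulr0 mul0r.
- by rewrite EXX /= !eqxx !mulr1.
Qed.

Let diagonal j a : E (X (j, j) ^+ a.+1) = v * a%:R * E (X (j, j) ^+ a.-1).
Proof.
apply: (@expect_real_gaussian _ _ _ _ _ (fun t => complex.Re (W j j t))).
- move=> t; have := W_hermitian j j t; rewrite /X /entry /=.
  case: (W j j t) => x y [] /eqP; rewrite -addr_eq0 -mulr2n mulrn_eq0 /=.
  by move=> /eqP ->.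
- have := (W_gaussian j j).2 1 0.
  by under eq_fun do rewrite mul1r mul0r addr0.
- exact: EX.
- by rewrite expr2 EXX /= !eqxx !mulr1.
Qed.

Lemma gue_wick p L :
  E (X p * monomial X L) = v * E (dmonomial X (transpose p) L).
Proof.
apply: wick.
- exact: W_hermitian.
- exact: W_independent.
- by move=> j k; case: (W_gaussian j k).
- exact: offdiagonal.
- exact: diagonal.
Qed.

Let r n : R[i] := ((Num.sqrt n%:R)^-1)%:C.

Let r2 n : (0 < n)%N -> r n ^+ 2 = n%:R^-1.
Proof.
move=> n0; rewrite /r -rmorphXn exprVn sqr_sqrtr // fmorphV /=.
by rewrite rmorph_nat.
Qed.

Let m k : R[i] := (semicircle_moment w k)%:C.

Let m0 : m 0 = 1. Proof. by rewrite /m semicircle_moment0. Qed.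

Let mS k : m k.+1 = v * \sum_(s < k) m s * m (k - s.+1)%N.
Proof.
rewrite /m semicircle_moment_convolution // rmorphM; congr (_ * _).
by rewrite rmorph_sum; apply: eq_bigr => s _; rewrite rmorphM.
Qed.

Let A n := normalized_trace (rv_cst P) X r n.

Let asymptotics l : cvg_inverse_square
  (fun n => E (\prod_(k <- l) A n k)) (\prod_(k <- l) m k).
Proof.
exact: (mixed_moment_asymptotics (@expect_cst_mul _ _ _ P) (@expect1 _ _ _ P)
  gue_wick r2 m0 mS).
Qed.

Let M t n := normalized_truncation (fun j k => W j k t) n.

Let M_hermitian t n : hermitian_mx (M t n).
Proof.
move=> j k; rewrite /M /normalized_truncation /truncation !mxE rmorphM /=.
by rewrite oppr0 -W_hermitian.
Qed.

Definition real_spectrum t n : seq R := [seq complex.Re z | z <- eigenvalues (M t n)].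

Lemma size_real_spectrum t n : size (real_spectrum t n) = n.
Proof. by rewrite size_map size_eigenvalues. Qed.

Definition spectral_moment k n t : R :=
  empirical_mean (real_spectrum t) n (fun x => x ^+ k).

(** Evaluation at [t] is a ring morphism, so it commutes with powers and traces. *)
Let AE n k t : A n k t = (spectral_moment k n t)%:C.
Proof.
have -> : A n k t = rv_eval t (A n k) by [].
rewrite /A /normalized_trace rmorphM /= /trace_power -trace_map_mx.
rewrite /spectral_moment /empirical_mean rmorphM fmorphV rmorph_nat; congr (_ * _).
rewrite /real_spectrum.
apply: (etrans _ (trace_power_real_eigenvalues k (@M_hermitian t n))); congr (\tr _).
rewrite (_ : M t n = map_mx (rv_eval t) (scaled_matrix (rv_cst P) X n (r n))).
  elim: k => [|k IH]; first by rewrite !expr0 map_mx1.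
  by rewrite !exprS -!mulmxE map_mxM IH.
by apply/matrixP => i j; rewrite !mxE rmorphM.
Qed.

Definition moment_deviation k n t : R := spectral_moment k n t - semicircle_moment w k.

Let DE n k t : (A n k - rv_cst P (m k)) t = (moment_deviation k n t)%:C.
Proof.
have -> : (A n k - rv_cst P (m k)) t = A n k t - m k by [].
by rewrite AE -rmorphB.
Qed.

Lemma finite_moments_deviation k n : finite_moments P (moment_deviation k n).
Proof.
have := rv_Re (A n k - rv_cst P (m k)).
by under eq_fun do rewrite DE.
Qed.

(** Expanding the square, the second moment of the deviation is a combination of
    mixed moments of at most two normalized traces. *)
Lemma moment_deviation_rate k : exists C : R, forall n, (0 < n)%N ->
  \int[P]_t (moment_deviation k n t ^+ 2) <= C / n%:R ^+ 2.
Proof.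
have ED n : E ((A n k - rv_cst P (m k)) ^+ 2) =
    E (\prod_(j <- [:: k; k]) A n j) +
    (- 2 * m k) * E (\prod_(j <- [:: k]) A n j) + m k ^+ 2.
  rewrite !big_cons big_nil !mulr1.
  have -> : (A n k - rv_cst P (m k)) ^+ 2 = A n k * A n k +
      rv_cst P (- 2 * m k) * A n k + rv_cst P (m k ^+ 2) * 1.
    by rewrite rmorphXn rmorphM rmorphN rmorph_nat /=; ring.
  by rewrite !raddfD /= !expect_cst_mul expect1 mulr1.
have : cvg_inverse_square (fun n => E ((A n k - rv_cst P (m k)) ^+ 2)) 0.
  have -> : 0 = \prod_(j <- [:: k; k]) m j +
      (- 2 * m k) * \prod_(j <- [:: k]) m j + m k ^+ 2.
    by rewrite !big_cons big_nil; ring.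
  apply: (cvg_inverse_square_eq (cvg_inverse_squareD (cvg_inverse_squareD
    (asymptotics [:: k; k]) (cvg_inverse_squareZ (- 2 * m k) (asymptotics [:: k])))
    (cvg_inverse_square_cst _))) => n _.
  by rewrite ED.
move=> [C C0 hC]; exists (complex.Re C) => n n0; have := hC n n0.
have D2E t : ((A n k - rv_cst P (m k)) ^+ 2) t = (moment_deviation k n t ^+ 2)%:C.
  have -> : ((A n k - rv_cst P (m k)) ^+ 2) t =
    ((A n k - rv_cst P (m k)) t) ^+ 2 by rewrite expr2.
  by rewrite DE rmorphXn.
rewrite subr0 (expect_real D2E) normc_def /= expr0n addr0 sqrtr_sqr => h.
have {}h : `|\int[P]_t (moment_deviation k n t ^+ 2)| <= complex.Re (C / n%:R ^+ 2).
  by move: h; rewrite lecE /= => /andP[].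
apply: (le_trans (ler_norm _)); apply: (le_trans h).
rewrite (_ : n%:R ^- 2 = (n%:R ^- 2)%:C :> R[i]); last first.
  by rewrite fmorphV rmorphXn rmorph_nat.
by move: (C) => [x y] /=; rewrite mulr0 subr0.
Qed.

Lemma ae_cvg_spectral_moments : {ae P, forall t, forall k,
  spectral_moment k n t @[n --> \oo] --> semicircle_moment w k}.
Proof.
have h k : {ae P, forall t,
    spectral_moment k n t @[n --> \oo] --> semicircle_moment w k}.
  have [C hC] := moment_deviation_rate k.
  have := ae_cvg_square_rate (finite_moments_deviation k) hC.
  apply: filterS => t h; rewrite -(add0r (semicircle_moment w k)).
  have -> : spectral_moment k ^~ t =
      (fun n => moment_deviation k n t + semicircle_moment w k).
    by apply/funext => n; rewrite /moment_deviation subrK.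
  by apply: cvgD => //; exact: cvg_cst.
exact: ae_foralln.
Qed.

End gaussian_unitary_ensemble.

Theorem theorem2p1 (R : realType) (d : measure_display) (T : measurableType d)
    (P : probability T R) (w : R) (w_gt0 : 0 < w)
    (W : nat -> nat -> T -> R[i])
    (W_hermitian : forall (j k : nat) (t : T), W j k t = (W k j t)^*%C)
    (W_gaussian : forall j k : nat, complex_gaussian_rv P (W j k))
    (W_independent : mutually_independent P
       [set jk : nat * nat | (jk.1 <= jk.2)%N] (fun jk => W jk.1 jk.2))
    (W_mean : forall j k : nat, cexpectation P (W j k) = 0)
    (W_covariance : forall j k l m : nat,
       cexpectation P (fun t => W j k t * (W l m t)^*%C) =
       (2 * w ^+ 2 * (j == l)%:R * (k == m)%:R)%:C) :
  {ae P, forall t : T,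
     weakly_converges
       (fun n => eigenvalue_measure
                   (normalized_truncation (fun j k => W j k t) n))
       (semicircle w)}.
Proof.
have := ae_cvg_spectral_moments w_gt0 W_hermitian W_gaussian W_independent
  W_mean W_covariance.
apply: filterS => t ht f cf [C fC].
rewrite integral_semicircle //.
under eq_fun do rewrite (integral_eigenvalue_measure _ cf).
apply: cvg_EFin; first exact: nearW.
exact: (cvg_empirical_mean w_gt0 (size_real_spectrum W t) ht cf fC).
Qed.
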